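(* Let $\mathcal{Q}_M$ be a Denjoy–Carleman class. Let $\sigma:V\to W$ be a mapping of class $\mathcal{Q}_M$ between open subsets of $\mathbb{R}^n$, such that the Jacobian determinant $\det(\partial\sigma/\partial x)$ is a monomial $x^\gamma=x_1^{\gamma_1}\cdots x_n^{\gamma_n}$ ($\gamma\in\mathbb{N}^n$) times a nowhere vanishing factor. Let $g\in\mathcal{C}^\infty(W)$ and assume that $f:=g\circ\sigma\in\mathcal{Q}_M(V)$. Then, for every compact $K\subset V$, $g$ is of class $\mathcal{Q}_{M^{(p)}}$ on $\sigma(K)$, where $$p:=2|\gamma|+1;$$ i.e., there exist constants $A,B>0$ such that $$\left|\frac{\partial^{|\beta|}g}{\partial y^\beta}\right|\le A\,B^{|\beta|}\,\beta!\,M_{p|\beta|}\quad\text{on }\sigma(K),\ \text{for every }\beta\in\mathbb{N}^n.$$ Moreover, if $\mathcal{Q}_M$ is closed under differentiation (in particular, if $\mathcal{Q}_M$ is a quasianalytic Denjoy–Carleman class), then the same conclusion holds with $$p=|\gamma|+1.$$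
   Context: Notation: $\mathbb{N}$ is the set of nonnegative integers; for $\alpha\in\mathbb{N}^n$, $|\alpha|=\alpha_1+\cdots+\alpha_n$, $\alpha!=\alpha_1!\cdots\alpha_n!$. Functions are real-valued. Denjoy–Carleman classes. Let $M=(M_k)_{k\in\mathbb{N}}$ be a sequence of positive real numbers which is logarithmically convex, i.e., $(M_{k+1}/M_k)$ is nondecreasing. For $U\subset\mathbb{R}^n$ open, $\mathcal{Q}_M(U)$ is the set of $f\in\mathcal{C}^\infty(U)$ such that, for every compact $K\subset U$, there are constants $A,B>0$ with $$\left|\frac{\partial^{|\alpha|}f}{\partial x^\alpha}\right|\le A\,B^{|\alpha|}\,\alpha!\,M_{|\alpha|}\quad\text{on }K,\ \text{for every }\alpha\in\mathbb{N}^n.$$ A Denjoy–Carleman class is a class $\mathcal{Q}_M$ of this kind. A mapping is of class $\mathcal{Q}_M$ if its components are. $\mathcal{Q}_M$ is closed under differentiation if all partial derivatives of every $f\in\mathcal{Q}_M(U)$ belong to $\mathcal{Q}_M(U)$, for every open $U$. $\mathcal{Q}_M$ is a quasianalytic Denjoy–Carleman class if, in addition, (a) $\sup_{k\ge1}(M_{k+1}/M_k)^{1/k}<\infty$ and (b) $\sum_{k=0}^\infty \frac{M_k}{(k+1)M_{k+1}}=\infty$. (Condition (a) implies closure under differentiation.) Shifted class: for a positive integer $p$, $M^{(p)}$ is the sequence $M^{(p)}_j:=M_{pj}$ (again logarithmically convex), and $\mathcal{Q}_{M^{(p)}}$ is the corresponding Denjoy–Carleman class. *)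

(* Defs.v *)
From HB Require Import structures.
From mathcomp Require Import all_boot all_order all_algebra.
From mathcomp Require Import all_classical all_reals all_analysis.

Set Implicit Arguments.
Unset Strict Implicit.
Unset Printing Implicit Defensive.

Import Order.TTheory GRing.Theory Num.Theory.
Import numFieldNormedType.Exports.

Local Open Scope classical_set_scope.
Local Open Scope ring_scope.

(* Functions on an open set U of R^n are represented by total functions on
   'rV[R]_n; every notion below is evaluated only at points of U, where it
   depends only on the restriction to U because U is open. *)

Section Calculus.
Variables (R : realType) (n : nat).
Implicit Types (f : 'rV[R]_n -> R) (U K : set 'rV[R]_n).

Definition mindex := {ffun 'I_n -> nat}.

Definition mdeg (a : mindex) : nat := (\sum_(i < n) a i)%N.

Definition mfact (a : mindex) : nat := (\prod_(i < n) (a i)`!)%N.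

Definition monomial (a : mindex) (x : 'rV[R]_n) : R :=
  \prod_(i < n) x ord0 i ^+ a i.

Definition partial (i : 'I_n) f : 'rV[R]_n -> R :=
  fun x => 'D_(delta_mx ord0 i) f x.

(* d/dx_{i1} (d/dx_{i2} (... f)) for s = [:: i1; i2; ...] *)
Definition partials (s : seq 'I_n) f : 'rV[R]_n -> R := foldr partial f s.

Definition mpartial (a : mindex) f : 'rV[R]_n -> R :=
  partials (flatten [seq nseq (a i) i | i <- enum 'I_n]) f.

Definition smooth_on U f : Prop :=
  forall (s : seq 'I_n) (x : 'rV[R]_n), U x ->
    {for x, continuous (partials s f)} /\
    forall i : 'I_n, derivable (partials s f) x (delta_mx ord0 i).

End Calculus.

Section DenjoyCarleman.
Variable R : realType.
Implicit Type M : nat -> R.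

Definition log_convex M : Prop :=
  forall k : nat, M k.+1 / M k <= M k.+2 / M k.+1.

Definition DC_weight M : Prop := (forall k : nat, 0 < M k) /\ log_convex M.

Definition DC_bounds n M (f : 'rV[R]_n -> R) (K : set 'rV[R]_n) : Prop :=
  exists A B : R, [/\ 0 < A, 0 < B &
    forall (a : mindex n) (x : 'rV[R]_n), K x ->
      `|mpartial a f x| <= A * B ^+ mdeg a * (mfact a)%:R * M (mdeg a)].

Definition DC_class n M (U : set 'rV[R]_n) (f : 'rV[R]_n -> R) : Prop :=
  smooth_on U f /\
  forall K : set 'rV[R]_n, compact K -> K `<=` U -> DC_bounds M f K.

Definition DC_class_map n m M (U : set 'rV[R]_n) (s : 'rV[R]_n -> 'rV[R]_m) :
  Prop := forall i : 'I_m, DC_class M U (fun x => s x ord0 i).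

(* Closure under differentiation of the classes in n variables. *)
Definition DC_diff_closed (n : nat) M : Prop :=
  forall (U : set 'rV[R]_n) (f : 'rV[R]_n -> R), open U -> DC_class M U f ->
    forall a : mindex n, DC_class M U (mpartial a f).

Definition DC_quasianalytic M : Prop :=
  has_ubound [set (M k.+1 / M k) `^ (k%:R)^-1 | k in [set k | (1 <= k)%N]] /\
  (\sum_(0 <= k <oo) (M k / (k.+1%:R * M k.+1))%:E = +oo)%E.

Definition shift_weight (p : nat) M : nat -> R := fun j => M (p * j)%N.

End DenjoyCarleman.

(* Main.v *)
Require Import Defs.
From HB Require Import structures.
From mathcomp Require Import all_boot all_order all_algebra.
From mathcomp Require Import all_classical all_reals all_analysis.
From mathcomp Require Import ring lra zify.

Set Implicit Arguments.
Unset Strict Implicit.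
Unset Printing Implicit Defensive.

Import Order.TTheory GRing.Theory Num.Theory.
Import numFieldNormedType.Exports.

Local Open Scope classical_set_scope.
Local Open Scope ring_scope.

(** Write J for the matrix of the partial derivatives of sigma and
Delta = det J = x^gamma u.  The chain rule says that the gradient of
h o sigma is J times the gradient of h taken along sigma, so multiplying by
the adjugate of J gives, for every smooth h,

  sum_k (adj J)_(i,k) d_k (h o sigma) = x^gamma (u . ((d_i h) o sigma)).

With h a derivative of g, this expresses a derivative of g of the next order,
composed with sigma, through the previous one by a differentiation, products
with fixed functions, |gamma| divisions by coordinates and a division by the
unit u.  So it suffices to know what these operations cost for estimates

  |d^alpha f| <= A B^|alpha| alpha! w(|alpha|)   on U,

written [majorized U f A B w] below; B is called their rate.

- A product costs a constant factor, provided that the rate of one of the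
  factors is at least twice that of the other ([majorized_mul]).  The weights
  stay of the form M(.+q), because log-convexity gives
  M(i+c) M(j+q) <= M(c) M(i+j+q) when c <= q ([weight_shift_mul]).
- A division by a unit with a fixed majorant also costs a constant factor
  ([majorized_quotient]): all terms of the Leibniz formula except u d^alpha f
  involve lower derivatives of f, and they are small when B is large.
- If f = x_i k, then k is the mean of d_i f over the segment from x to its
  projection on x_i = 0, and d^alpha k is the mean of d^(alpha+e_i) f against
  the density t^(alpha_i).  The integral of this density, 1/(alpha_i + 1),
  cancels the extra factor of (alpha+e_i)!, so that a division shifts the
  weight by one and costs no factorial ([majorized_division]).
- A derivative shifts the weight by one and produces a factor
  |alpha| + 1, which is absorbed by increasing the rate slightly: passing from
  B(1 + s/(N+1)) to B(1 + (s+1)/(N+1)) costs a factor of order N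
  ([majorized_partial], [rate_step]).

Hence every derivative of g shifts the weight by |gamma| + 1, and N
derivatives, computed with rates between B and 2B, cost at most
K^N (N+1)^N <= C^N beta! when |beta| = N ([iteration], [succ_expn_le_mfact]).

This is done on a small cube around a point a of V.  The divisions use
segments that must remain in the cube, so only the coordinates with a_i = 0
are divided out, and the powers of the other ones, which do not vanish near a,
are put into the unit ([local_bound]).  Compactness then gives the estimate
on sigma(K) with exponent |gamma| + 1.  As M_(k+1) / M_k >= M_1 / M_0,
M_(pk) <= C^k M_(qk) for p <= q, so the estimate with 2|gamma| + 1 follows. *)

(** * Mean values and differentiability *)

Section Lines.
Variables (R : realType) (n : nat).
Implicit Types f : 'rV[R]_n -> R.

Lemma is_derive_line f (x v : 'rV[R]_n) (t : R) : derivable f (t *: v + x) v ->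
  is_derive t 1 (fun s : R => f (s *: v + x)) ('D_v f (t *: v + x)).
Proof.
have E : (fun h => h^-1 *: (((fun s : R => f (s *: v + x)) \o shift t) (h *: 1) -
      f (t *: v + x))) =
   (fun h => h^-1 *: ((f \o shift (t *: v + x)) (h *: v) - f (t *: v + x))).
  apply/funext => h /=; congr (_ *: (f _ - _)).
  by rewrite [_%:A]mulr1 scalerDl addrA.
by move=> df; apply: DeriveDef; rewrite /derivable /derive E.
Qed.

(** The intermediate point is only located by its absolute value, so that the
same statement serves both signs of [t]. *)
Lemma line_mvt f (x v : 'rV[R]_n) (t : R) :
  (forall s : R, `|s| <= `|t| -> derivable f (s *: v + x) v) ->
  exists2 c, `|c| <= `|t| & f (t *: v + x) - f x = t * 'D_v f (c *: v + x).
Proof.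
move=> df.
pose F (s : R) := f (s *: v + x).
have dF (s : R) : `|s| <= `|t| -> is_derive s 1 F ('D_v f (s *: v + x)).
  by move=> st; apply: is_derive_line; exact: df.
have cF a b : (forall s : R, a <= s <= b -> `|s| <= `|t|) ->
    {within `[a, b], continuous F}.
  move=> ab; apply: derivable_within_continuous => s; rewrite in_itv/= => /ab st.
  by have [] := dF _ st.
have F0 : F 0 = f x by rewrite /F scale0r add0r.
have [t0|t0] := leP 0 t.
  have ab s : 0 <= s <= t -> `|s| <= `|t|.
    by move=> /andP[s0 st]; rewrite !ger0_norm.
  have [s|c] := @MVT_segment R F (fun s => 'D_v f (s *: v + x)) 0 t t0 _ (cF _ _ ab).
    by rewrite in_itv/= => /andP[s0 st]; apply/dF/ab; rewrite !ltW.
  rewrite in_itv/= => /ab ct; rewrite F0 subr0 mulrC => fE.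
  by exists c.
have ab s : t <= s <= 0 -> `|s| <= `|t|.
  move=> /andP[s0 st]; rewrite !ler0_norm ?lerN2 //; exact: ltW.
have [s|c] := @MVT_segment R F (fun s => 'D_v f (s *: v + x)) t 0 (ltW t0) _ (cF _ _ ab).
  by rewrite in_itv/= => /andP[s0 st]; apply/dF/ab; rewrite !ltW.
rewrite in_itv/= => /ab ct; rewrite F0 sub0r mulrN => fE.
by exists c => //; rewrite -opprB fE opprK mulrC.
Qed.

End Lines.

Section ContinuousPartials.
Variables (R : realType) (n : nat).
Implicit Types f : 'rV[R]_n -> R.

Local Notation e i := (delta_mx ord0 i : 'rV[R]_n).

Lemma coord_le_norm (v : 'rV[R]_n) i : `|v ord0 i| <= `|v|.
Proof. by rewrite [leRHS]/Num.norm/= mx_normrE; exact: (le_bigmax _ _ (ord0, i)). Qed.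

Lemma norm_delta_le1 i : `|e i| <= 1.
Proof.
rewrite [leLHS]/Num.norm/= mx_normrE; apply/bigmax_leP; split=> // -[a b] _ /=.
by rewrite mxE normr_nat lern1; case: (_ && _).
Qed.

(** One coordinate is moved at a time, the mean value theorem being applied to
each move.  The list [l] may have repetitions; the crude bound
[size l * |v|] on the total displacement is all that the induction needs. *)
Lemma coordinate_increment f (x : 'rV[R]_n) (eps d : R) (l : seq 'I_n) (v y : 'rV[R]_n) :
  (forall z, `|z - x| < d -> forall i, derivable f z (e i) /\
     `|partial i f z - partial i f x| <= eps) ->
  `|y - x| + (size l)%:R * `|v| < d ->
  `|f (y + \sum_(i <- l) v ord0 i *: e i) - f y -
    \sum_(i <- l) v ord0 i * partial i f x| <= (size l)%:R * eps * `|v|.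
Proof.
move=> fd; elim: l y => [|i l IH] y yx.
  by rewrite !big_nil addr0 !subrr normr0 !mul0r.
have sE : (size (i :: l))%:R = 1 + (size l)%:R :> R by rewrite /= -addn1 natrD addrC.
rewrite !big_cons.
set s := \sum_(j <- l) _; set t := \sum_(j <- l) _.
have small c : `|c| <= `|v ord0 i| -> `|c *: e i + y - x| <= `|y - x| + `|v|.
  move=> ci; rewrite -addrA addrC; apply: le_trans (ler_normD _ _) _.
  rewrite lerD2l normrZ -[leRHS]mulr1 ler_pM ?norm_delta_le1 //.
  exact: le_trans ci (coord_le_norm _ _).
have lt_d z : `|z - x| <= `|y - x| + `|v| -> `|z - x| + (size l)%:R * `|v| < d.
  by move=> zx; apply: le_lt_trans yx; rewrite sE mulrDl mul1r addrA lerD2r.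
have lt_d' z : `|z - x| <= `|y - x| + `|v| -> `|z - x| < d.
  by move=> /lt_d; apply: le_lt_trans; rewrite lerDl mulr_ge0.
have [c|c ci fE] := @line_mvt _ _ f y (e i) (v ord0 i).
  by move=> ci; have [] := fd _ (lt_d' _ (small _ ci)) i.
have [_ pc] := fd _ (lt_d' _ (small _ ci)) i.
have := IH (v ord0 i *: e i + y) (lt_d _ (small _ (lexx _))).
rewrite -/s -/t => IHy.
rewrite [X in X <= _](_ : _ = `|(f (v ord0 i *: e i + y + s) - f (v ord0 i *: e i + y) - t)
  + v ord0 i * (partial i f (c *: e i + y) - partial i f x)|); last first.
  rewrite mulrBr /partial -fE; congr `| _ |.
  by rewrite [y + _]addrA [y + _]addrC; ring.
apply: le_trans (ler_normD _ _) _.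
rewrite sE mulrDl mul1r mulrDl addrC lerD // normrM mulrC.
by rewrite ler_pM // coord_le_norm.
Qed.

(** The classical criterion: the increment of [f] along the broken line of
[coordinate_increment] differs from the linear map given by the partial
derivatives at [x] by o(|v|). *)
Lemma differentiable_partials f (x : 'rV[R]_n) :
  (\forall y \near x, forall i, derivable f y (e i)) ->
  (forall i, {for x, continuous (partial i f)}) -> differentiable f x.
Proof.
move=> df cf.
pose L (v : 'rV[R]_n) : R := \sum_i v ord0 i * partial i f x.
have linL : linear L.
  move=> a u v; rewrite /L scaler_sumr -big_split; apply: eq_bigr => i _ /=.
  by rewrite !mxE mulrDl -mulrA.
pose LM := GRing.isLinear.Build _ _ _ _ _ linL.
pose LL : {linear 'rV[R]_n -> R} := HB.pack L LM.
have cL : continuous LL.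
  apply: continuous_big; first exact: add_continuous.
  move=> i _ v; apply: (@continuousM _ _ (fun v : 'rV[R]_n => v ord0 i)
    (fun=> partial i f x)); last exact: cst_continuous.
  exact: coord_continuous.
have dE := @diff_unique R 'rV[R]_n R^o f LL x cL.
suff dL : forall eps : R, 0 < eps ->
    \forall v \near (0 : 'rV[R]_n), `|f (v + x) - (f x + L v)| <= eps * `|v|.
  have {}dE : 'd f x = LL :> ('rV[R]_n -> R) by apply: dE; exact/eqaddoP.
  by apply/diff_locallyP; rewrite dE; split => //; exact/eqaddoP.
move=> eps eps0.
have e'0 : 0 < eps / n.+1%:R by rewrite divr_gt0.
have : \forall z \near x, forall i, derivable f z (e i) /\
    `|partial i f z - partial i f x| <= eps / n.+1%:R.
  have c' : \forall z \near x, forall i, `|partial i f z - partial i f x| <= eps / n.+1%:R.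
    apply: (@filter_forall _ _
      (fun i z => `|partial i f z - partial i f x| <= eps / n.+1%:R) (nbhs x) _) => i.
    move/cvgrPdist_le : (cf i) => /(_ _ e'0).
    by apply: filterS => z; rewrite distrC.
  by apply: filterS2 df c' => z dz cz i; split.
move=> /nbhs_ballP[d /= d0 dB].
have dB' z : `|z - x| < d -> forall i, derivable f z (e i) /\
    `|partial i f z - partial i f x| <= eps / n.+1%:R.
  by move=> zx; apply: dB; rewrite -ball_normE /= distrC.
near=> v.
have vd : `|v| < d / n.+1%:R.
  near: v; apply: filterS (nbhsx_ballx (0 : 'rV[R]_n) (d / n.+1%:R) _).
    by move=> v; rewrite -ball_normE /= sub0r normrN.
  by rewrite divr_gt0.
have nE : size (index_enum 'I_n) = n by rewrite -[index_enum _]enumT size_enum_ord.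
have := @coordinate_increment f x _ d (index_enum 'I_n) v x dB'.
rewrite subrr normr0 add0r nE => /(_ _)/wrap[].
  move: vd; rewrite ltr_pdivlMr ?ltr0n // => vd; apply: le_lt_trans vd.
  by rewrite mulrC ler_wpM2l // ler_nat.
rewrite -row_sum_delta => H.
rewrite [v + x]addrC opprD addrA; apply: le_trans H _.
rewrite ler_wpM2r // mulrC -mulrA ler_piMr ?(ltW eps0) //.
by rewrite mulrC ler_pdivrMr ?ltr0n // mul1r ler_nat.
Unshelve. all: by end_near. Qed.

End ContinuousPartials.

(** * Smooth functions: mixed derivatives, products, composition *)

Section Smooth.
Variable R : realType.

Lemma dist_halves (a b c eps : R) :
  `|a - c| <= eps / 2 -> `|b - c| <= eps / 2 -> `|a - b| <= eps.
Proof.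
move=> ac bc; rewrite -(subrKA c) (splitr eps).
by apply: le_trans (ler_normD _ _) _; rewrite lerD // distrC.
Qed.

Lemma continuous_rV (T : topologicalType) m (s : T -> 'rV[R]_m) (x : T) :
  (forall j, {for x, continuous (fun y => s y ord0 j)}) -> {for x, continuous s}.
Proof.
move=> cs; apply/(@cvgrPdist_lt R 'rV[R]_m _ (nbhs x) (nbhs_filter x) s (s x)) => eps eps0.
have H : \forall y \near x, forall j, `|s x ord0 j - s y ord0 j| < eps.
  apply: (@filter_forall _ _ (fun j y => `|s x ord0 j - s y ord0 j| < eps) (nbhs x) (nbhs_filter x)).
  by move=> j; move/cvgrPdist_lt : (cs j); apply.
apply: filterS H => y H; rewrite [ltLHS]/Num.norm/= mx_normrE.
by apply/bigmax_ltP; split=> // -[a b] _ /=; rewrite ord1 !mxE.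
Qed.

Section Fixed.
Variable n : nat.
Implicit Types (f g : 'rV[R]_n -> R) (U : set 'rV[R]_n).

Local Notation e i := (delta_mx ord0 i : 'rV[R]_n).

Lemma open_near U x : open U -> U x -> \forall y \near x, U y.
Proof. by move=> oU Ux; apply: open_nbhs_nbhs. Qed.

Lemma partial_congr U f g : open U -> (forall x, U x -> f x = g x) ->
  forall i x, U x -> partial i f x = partial i g x.
Proof.
move=> oU fg i x Ux; apply: near_eq_derive.
by apply: filterS (open_near oU Ux) => y /fg.
Qed.

Lemma partials_congr U f g : open U -> (forall x, U x -> f x = g x) ->
  forall s x, U x -> partials s f x = partials s g x.
Proof. by move=> oU fg; elim=> [|i s IH]; [exact: fg|exact: (partial_congr oU IH)]. Qed.

Lemma partials_cat s t f : partials (s ++ t) f = partials s (partials t f).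
Proof. exact: foldr_cat. Qed.

Lemma smooth_partials U f s : smooth_on U f -> smooth_on U (partials s f).
Proof. by move=> sf t x Ux; rewrite -partials_cat; exact: sf. Qed.

(** Finite order smoothness, defined by recursion on the order: stability under
products and composition is proved by induction on the order, since the
derivative of a product involves the factors themselves. *)
Fixpoint Ck (k : nat) U f : Prop :=
  (forall x, U x -> {for x, continuous f}) /\
  (if k is k'.+1 then forall i, (forall x, U x -> derivable f x (e i)) /\
     Ck k' U (partial i f) else True).

Lemma Ck_cont k U f x : Ck k U f -> U x -> {for x, continuous f}.
Proof. by case: k => [|k] [cf _]; exact: cf. Qed.

(** The innermost derivative of [partials s f] is the last element of [s],
hence the induction from the right end of [s]. *)
Lemma smooth_Ck U f : smooth_on U f <-> forall k, Ck k U f.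
Proof.
split=> [sf k|Cf s x Ux].
  elim: k f sf => [|k IH] f sf; first by split=> // x /(sf [::])[].
  split=> [x /(sf [::])[] //|i].
  split=> [x /(sf [::])[] _ H|]; first exact: H.
  exact: (IH _ (@smooth_partials U f [:: i] sf)).
elim/last_ind: s f Cf => [|s i IH] f Cf.
  by have [cf df] := Cf 1%N; split=> [|i]; [exact: cf|have [+ _] := df i; exact].
rewrite -cats1 partials_cat; apply: IH => k.
by have [_ /(_ i)[]] := Cf k.+1.
Qed.

Lemma Ck_congr k U f g : open U -> (forall x, U x -> f x = g x) ->
  Ck k U f -> Ck k U g.
Proof.
move=> oU; have C f' g' : (forall x, U x -> f' x = g' x) ->
   (forall x, U x -> {for x, continuous f'}) -> forall x, U x -> {for x, continuous g'}.
  move=> fg cf x Ux; rewrite /prop_for /continuous_at -fg //.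
  apply: cvg_trans (cf _ Ux); apply: (@near_eq_cvg _ _ (nbhs x)); rewrite near_simpl.
  by have := open_near oU Ux; apply: filterS => y /fg.
elim: k f g => [|k IH] f g fg [cf df]; split=> //; try exact: C cf.
move=> i; have [d1 d2] := df i; split=> [x Ux|].
  apply: near_eq_derivable (d1 _ Ux).
  by have := open_near oU Ux; apply: filterS => y /fg.
by apply: IH d2; exact: partial_congr.
Qed.

Lemma CkW k U f : Ck k.+1 U f -> Ck k U f.
Proof.
elim: k f => [|k IH] f [cf df]; split=> //.
by move=> i; have [d1 d2] := df i; split=> //; exact: IH.
Qed.

Lemma Ck_cst k U (c : R) : Ck k U (fun=> c).
Proof.
elim: k c => [|k IH] c; split=> //; try by move=> x _; exact: cst_continuous.
move=> i; split=> [x _|]; first exact: derivable_cst.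
rewrite (_ : partial i _ = fun=> 0) //.
by apply/funext => x; rewrite /partial derive_cst.
Qed.

Lemma Ck_add k U f g : open U -> Ck k U f -> Ck k U g ->
  Ck k U (fun x => f x + g x).
Proof.
move=> oU; elim: k f g => [|k IH] f g [cf df] [cg dg]; split=> //.
- by move=> x Ux; apply: (@continuousD _ R^o); [exact: cf|exact: cg].
- by move=> x Ux; apply: (@continuousD _ R^o); [exact: cf|exact: cg].
move=> i; have [d1 d2] := df i; have [d3 d4] := dg i; split=> [x Ux|].
  by apply: derivableD; [exact: d1|exact: d3].
apply: Ck_congr (IH _ _ d2 d4) => // x Ux.
by rewrite /partial -deriveD //; [exact: d1|exact: d3].
Qed.

Lemma Ck_mul k U f g : open U -> Ck k U f -> Ck k U g ->
  Ck k U (fun x => f x * g x).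
Proof.
move=> oU; elim: k f g => [|k IH] f g; move=> [cf df] [cg dg]; split=> //.
- by move=> x Ux; apply: continuousM; [exact: cf|exact: cg].
- by move=> x Ux; apply: continuousM; [exact: cf|exact: cg].
move=> i; have [d1 d2] := df i; have [d3 d4] := dg i; split=> [x Ux|].
  by apply: derivableM; [exact: d1|exact: d3].
have Cf : Ck k U f by apply: CkW.
have Cg : Ck k U g by apply: CkW.
apply: Ck_congr (Ck_add oU (IH _ _ Cf d4) (IH _ _ Cg d2)) => // x Ux.
by rewrite /partial -deriveM //; [exact: d1|exact: d3].
Qed.

Lemma Ck_sum k U (I : Type) (r : seq I) (F : I -> 'rV[R]_n -> R) : open U ->
  (forall i, Ck k U (F i)) -> Ck k U (fun x => \sum_(i <- r) F i x).
Proof.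
move=> oU CF; elim: r => [|i r IH].
  by under eq_fun do rewrite big_nil; exact: Ck_cst.
by under eq_fun do rewrite big_cons; exact: Ck_add.
Qed.

Lemma Ck_differentiable k U f x : open U -> Ck k.+1 U f -> U x -> differentiable f x.
Proof.
move=> oU [cf df] Ux; apply: differentiable_partials.
  by apply: filterS (open_near oU Ux) => y Uy i; have [+ _] := df i; exact.
by move=> i; have [_ /Ck_cont] := df i; exact.
Qed.

Lemma smooth_differentiable U f x : open U -> smooth_on U f -> U x -> differentiable f x.
Proof. by move=> oU /smooth_Ck/(_ 1%N); exact: Ck_differentiable. Qed.

Lemma partial_sum_diff f x (v : 'rV[R]_n) : differentiable f x ->
  'd f x v = \sum_i v ord0 i * partial i f x.
Proof.
move=> df; rewrite {1}(row_sum_delta v) linear_sum; apply: eq_bigr => i _.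
by rewrite linearZ /partial deriveE.
Qed.

Definition second_difference f x (h : R) i j : R :=
  f (h *: e i + (h *: e j + x)) - f (h *: e i + x) - (f (h *: e j + x) - f x).

Lemma second_differenceC f x h i j :
  second_difference f x h i j = second_difference f x h j i.
Proof. by rewrite /second_difference [_ *: e i + (_ + _)]addrCA; ring. Qed.

(** Two applications of the mean value theorem, first along [e i] to the
increment of [f] in direction [e j], then along [e j] to [partial i f]. *)
Lemma second_difference_mvt f x (h d : R) i j : Ck 2 (ball x d) f ->
  2 * `|h| < d ->
  exists2 p, `|p - x| <= 2 * `|h| &
    second_difference f x h i j = h * (h * partial j (partial i f) p).
Proof.
move=> [cf df] hd.
have inB a b : `|a| <= `|h| -> `|b| <= `|h| ->
    `|a *: e i + (b *: e j + x) - x| <= 2 * `|h|.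
  move=> ah bh; rewrite addrA addrK; apply: le_trans (ler_normD _ _) _.
  rewrite mulr2n mulrDl mul1r !normrZ lerD // -[leRHS]mulr1;
  by rewrite ler_pM ?norm_delta_le1.
have B a b : `|a| <= `|h| -> `|b| <= `|h| ->
    ball x d (a *: e i + (b *: e j + x)).
  move=> ah bh; rewrite -ball_normE /= distrC; apply: le_lt_trans hd; exact: inB.
have h0 : `|0 : R| <= `|h| by rewrite normr0.
have [di /= [_ dij]] := df i.
pose F y := f (h *: e j + y) - f y.
have dF s : `|s| <= `|h| -> is_derive (s *: e i + x) (e i) F
    (partial i f (s *: e i + (h *: e j + x)) - partial i f (s *: e i + x)).
  move=> sh; apply: is_deriveB; last first.
    by apply: DeriveDef => //; apply: di; have := B _ _ sh h0; rewrite scale0r add0r.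
  have E : (fun k => k^-1 *: (((fun y => f (h *: e j + y)) \o shift (s *: e i + x)) (k *: e i) -
      f (h *: e j + (s *: e i + x)))) =
    (fun k => k^-1 *: ((f \o shift (s *: e i + (h *: e j + x))) (k *: e i) -
        f (s *: e i + (h *: e j + x)))).
    apply/funext => k /=; congr (_ *: (f _ - f _)); last by rewrite addrCA.
    by rewrite addrCA [h *: _ + (s *: _ + x)]addrCA.
  by apply: DeriveDef; [rewrite /derivable E; exact: di (B _ _ sh _)|rewrite /derive E].
have [s sh|c ch FE] := @line_mvt _ _ F x (e i) h; first by have [] := dF _ sh.
have [s sh|c' c'h gE] := @line_mvt _ _ (partial i f) (c *: e i + x) (e j) h.
  by have [+ _] := dij j; apply; rewrite addrCA; exact: B.
exists (c *: e i + (c' *: e j + x)); first exact: inB.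
have [_ dE] := dF _ ch.
have -> : second_difference f x h i j = F (h *: e i + x) - F x.
  by rewrite /second_difference /F; congr (f _ - _ - _); rewrite addrCA.
rewrite {}FE; congr (h * _); apply: etrans dE _.
have E : partial i f (c *: e i + (h *: e j + x)) =
    partial i f (h *: e j + (c *: e i + x)) by congr (partial i f _); exact: addrCA.
have E' : c *: e i + (c' *: e j + x) = c' *: e j + (c *: e i + x) by exact: addrCA.
by rewrite E E'; exact: gE.
Qed.

(** The second difference is symmetric in [i] and [j], so the two mixed
derivatives agree at points arbitrarily close to [x], hence at [x]. *)
Lemma schwarz U f i j x : open U -> Ck 2 U f -> U x ->
  partial i (partial j f) x = partial j (partial i f) x.
Proof.
move=> oU Cf Ux.
have cont k l : {for x, continuous (partial k (partial l f))}.
  by have [_ /(_ l)[_ [_ /(_ k)[_ [cf _]]]]] := Cf; exact: cf.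
apply/eqP; rewrite -subr_eq0 -normr_eq0; apply/eqP/le_anti; rewrite normr_ge0 andbT.
apply/ler_addgt0Pl => eps eps0; rewrite addr0.
have near_eps k l : \forall p \near x,
    `|partial k (partial l f) x - partial k (partial l f) p| <= eps / 2.
  by move/cvgrPdist_le: (cont k l); apply; rewrite divr_gt0.
have /nbhs_ballP[d /= d0 dB] : \forall p \near x, [/\ U p,
   `|partial i (partial j f) x - partial i (partial j f) p| <= eps / 2 &
   `|partial j (partial i f) x - partial j (partial i f) p| <= eps / 2].
  by apply: filterS3 (open_near oU Ux) (near_eps i j) (near_eps j i) => p.
have CB : Ck 2 (ball x d) f.
  have sub k g : Ck k U g -> Ck k (ball x d) g.
    elim: k g => [|k IH] g [cg dg]; split=> //; try by move=> y /dB[Uy _ _]; exact: cg.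
    move=> l; have [d1 d2] := dg l; split; last exact: IH.
    by move=> y /dB[Uy _ _]; exact: d1.
  exact: sub.
pose h := d / 4.
have h0 : 0 < h by rewrite divr_gt0.
have hd : 2 * `|h| < d by rewrite gtr0_norm // /h; lra.
have [p px pE] := second_difference_mvt i j CB hd.
have [q qx qE] := second_difference_mvt j i CB hd.
have E : partial j (partial i f) p = partial i (partial j f) q.
  have hn : h != 0 by rewrite gt_eqF.
  exact: (mulfI hn (mulfI hn (etrans (esym pE) (etrans (second_differenceC _ _ _ _ _) qE)))).
have [_ _ Hp] : [/\ U p,
   `|partial i (partial j f) x - partial i (partial j f) p| <= eps / 2 &
   `|partial j (partial i f) x - partial j (partial i f) p| <= eps / 2].
  by apply: dB; rewrite -ball_normE /= distrC; exact: le_lt_trans hd.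
have [_ Hq _] : [/\ U q,
   `|partial i (partial j f) x - partial i (partial j f) q| <= eps / 2 &
   `|partial j (partial i f) x - partial j (partial i f) q| <= eps / 2].
  by apply: dB; rewrite -ball_normE /= distrC; exact: le_lt_trans hd.
rewrite E in Hp; exact: (dist_halves Hq Hp).
Qed.

Lemma partials_perm U f s t : open U -> smooth_on U f -> perm_eq s t ->
  forall x, U x -> partials s f x = partials t f x.
Proof.
move=> oU sf.
have move1 i t1 t2 x : U x -> partials (t1 ++ i :: t2) f x = partials (i :: t1 ++ t2) f x.
  elim: t1 x => [//|j t1 IH] x Ux; rewrite [LHS]/= [RHS]/=.
  apply: etrans (partial_congr oU IH j Ux) _.
  by apply: (schwarz j i oU _ Ux); exact: ((smooth_Ck _ _).1 (smooth_partials _ sf) 2%N).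
elim: s t => [|i s IH] t; first by move/perm_size; case: t.
move=> st x Ux; have it : i \in t by rewrite -(perm_mem st) inE eqxx.
case/splitPr: it st => t1 t2 st.
apply: etrans (esym (move1 _ _ _ _ Ux)).
apply: (partial_congr oU _ i Ux) => y Uy; apply: IH Uy.
by rewrite -(perm_cons i); apply: perm_trans st _; rewrite perm_catC /= perm_cons perm_catC.
Qed.

End Fixed.

Section Chain.
Variables n m : nat.
Variables (V : set 'rV[R]_n) (W : set 'rV[R]_m) (sigma : 'rV[R]_n -> 'rV[R]_m).
Hypotheses (oV : open V) (oW : open W) (sVW : forall x, V x -> W (sigma x)).
Local Notation coord j := (fun x => sigma x ord0 j).

Lemma differentiable_rV x : (forall j, differentiable (coord j) x) ->
  differentiable sigma x.
Proof.
move=> ds.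
have -> : sigma = \sum_(j < m) (fun y => sigma y ord0 j *: (delta_mx ord0 j : 'rV[R]_m)).
  by apply/funext => y; rewrite fct_sumE; exact: row_sum_delta.
by apply: differentiable_sum => j; apply: differentiableZl.
Qed.

Lemma derive_coord x (v : 'rV[R]_n) j : differentiable sigma x ->
  ('d sigma x v) ord0 j = 'D_v (coord j) x.
Proof.
by move=> ds; rewrite -deriveE // derive_mx ?mxE //; exact: diff_derivable.
Qed.

Lemma chain_rule f x i : differentiable f (sigma x) -> differentiable sigma x ->
  partial i (f \o sigma) x =
  \sum_j partial j f (sigma x) * partial i (coord j) x.
Proof.
move=> df ds; rewrite /partial deriveE; last exact: differentiable_comp.
rewrite diff_comp //= partial_sum_diff //; apply: eq_bigr => j _.
by rewrite derive_coord // mulrC.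
Qed.

(** By the chain rule a partial derivative of the composite is a sum of products
of a composite of lower order with a derivative of the inner map. *)
Lemma Ck_comp k f : (forall j, Ck k V (coord j)) -> Ck k W f -> Ck k V (f \o sigma).
Proof.
elim: k f => [|k IH] f Cs Cf.
  split=> // x Vx; apply: continuous_comp.
    by apply: continuous_rV => j; exact: Ck_cont (Cs j) Vx.
  exact: Ck_cont Cf (sVW Vx).
have ds x : V x -> differentiable sigma x.
  by move=> Vx; apply: differentiable_rV => j; exact: Ck_differentiable (Cs j) Vx.
have df x : V x -> differentiable f (sigma x).
  by move=> Vx; exact: Ck_differentiable Cf (sVW Vx).
split=> [x Vx|i].
  by apply: differentiable_continuous; apply: differentiable_comp; [exact: ds|exact: df].
split=> [x Vx|].
  by apply: diff_derivable; apply: differentiable_comp; [exact: ds|exact: df].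
have C j : Ck k V (fun x => (partial j f \o sigma) x * partial i (coord j) x).
  apply: Ck_mul => //; last by have [_ /(_ i)[]] := Cs j.
  by apply: IH => [l|]; [exact: CkW|have [_ /(_ j)[]] := Cf].
apply: Ck_congr (Ck_sum (index_enum 'I_m) oV C) => // x Vx.
by rewrite chain_rule; [|exact: df|exact: ds].
Qed.

End Chain.
End Smooth.

(** * Integrals over the unit interval *)

Section UnitIntegral.
Variable R : realType.
Implicit Types (F G : R -> R).

Definition int01 G : R := \int[@lebesgue_measure R]_(t in `[0, 1]) G t.

Definition cont01 G := forall t : R, 0 <= t <= 1 -> {for t, continuous G}.

Lemma cont01_within G : cont01 G -> {within `[0, 1], continuous G}.
Proof.
by move=> cG; apply: continuous_in_subspaceT => t; rewrite inE/= in_itv/=; exact: cG.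
Qed.

Lemma cont01_integrable G : cont01 G ->
  (@lebesgue_measure R).-integrable `[0, 1] (EFin \o G).
Proof.
move=> cG; apply: continuous_compact_integrable; first exact: segment_compact.
exact: cont01_within.
Qed.

Lemma int01_FTC F G :
  (forall t : R, 0 <= t <= 1 -> derivable F t 1 /\ 'D_1 F t = G t) ->
  cont01 G -> int01 G = F 1 - F 0.
Proof.
move=> dF cG; rewrite /int01 /Rintegral (@continuous_FTC2 _ _ F) //.
- exact: cont01_within.
- have cF t : 0 <= t <= 1 -> {for t, continuous F}.
    by move=> /dF[dFt _]; apply: differentiable_continuous; exact/derivable1_diffP.
  split.
  + by move=> t; rewrite in_itv/= => /andP[t0 t1]; have [|] := dF t; rewrite ?ltW.
  + by apply: cvg_at_right_filter; apply: cF; rewrite lexx ler01.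
  + by apply: cvg_at_left_filter; apply: cF; rewrite lexx ler01.
- move=> t; rewrite in_itv/= => /andP[t0 t1]; rewrite derive1E.
  by have [|] := dF t; rewrite ?ltW.
Qed.

Lemma cont01_exp m : cont01 (fun t => t ^+ m).
Proof. by move=> t _; exact: exprn_continuous. Qed.

Lemma int01_exp m : int01 (fun t => t ^+ m) = m.+1%:R^-1.
Proof.
pose F (t : R) : R := m.+1%:R^-1 * t ^+ m.+1.
have dF (t : R) : is_derive t 1 F (t ^+ m).
  have dX : is_derive t 1 (fun s : R => s ^+ m.+1) (m.+1%:R * t ^+ m).
    apply: DeriveDef; first exact: exprn_derivable.
    by rewrite exp_derive [LHS]mulr1.
  have dX' : derivable (fun s : R => s ^+ m.+1) t 1 by case: dX.
  apply: DeriveDef; first by apply: derivableM; [exact: derivable_cst|exact: dX'].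
  by rewrite deriveMl // derive_val mulrA mulVf ?pnatr_eq0 // mul1r.
have -> : int01 (fun t : R => t ^+ m) = F 1 - F 0.
  by apply: int01_FTC => [t _|]; [case: (dF t)|exact: cont01_exp].
by rewrite /F expr1n expr0n mulr0 subr0 mulr1.
Qed.

Lemma cont01_expM m G : cont01 G -> cont01 (fun t => t ^+ m * G t).
Proof. by move=> cG t t01; apply: continuousM; [exact: cont01_exp|exact: cG]. Qed.

(** This is where the gain 1/(m+1) of the division by a coordinate comes
from. *)
Lemma int01_exp_le m G S : cont01 G ->
  (forall t, 0 <= t <= 1 -> `|G t| <= S) ->
  `|int01 (fun t => t ^+ m * G t)| <= S / m.+1%:R.
Proof.
move=> cG GS; have cmG := cont01_expM (m := m) cG.
apply: le_trans (le_normr_Rintegral _ (cont01_integrable cmG)) _ => //.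
rewrite -int01_exp /int01 -RintegralZl //; last exact: (cont01_integrable (@cont01_exp m)).
apply: le_Rintegral => //.
- apply: cont01_integrable => t t01; apply: continuous_comp; first exact: cmG.
  exact: norm_continuous.
- apply: cont01_integrable => t t01; apply: continuousM; first exact: cst_continuous.
  exact: cont01_exp.
move=> t /=; rewrite in_itv/= => t01; have t0 : 0 <= t by case/andP: t01.
by rewrite normrM ger0_norm ?exprn_ge0 // mulrC ler_wpM2r ?exprn_ge0 // GS.
Qed.

Lemma int01B F G : cont01 F -> cont01 G ->
  int01 (fun t => F t - G t) = int01 F - int01 G.
Proof. by move=> cF cG; rewrite -RintegralB //; exact: cont01_integrable. Qed.

Lemma int01Z c G : cont01 G -> int01 (fun t => c * G t) = c * int01 G.
Proof. by move=> cG; rewrite -RintegralZl //; exact: cont01_integrable. Qed.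

Lemma eq_int01 F G : (forall t, 0 <= t <= 1 -> F t = G t) -> int01 F = int01 G.
Proof.
by move=> FG; apply: eq_Rintegral => t; rewrite inE/= in_itv/=; exact: FG.
Qed.

End UnitIntegral.

(** * Division of a smooth function by a coordinate *)

Section Hadamard.
Variables (R : realType) (n : nat) (i : 'I_n) (Q : set 'rV[R]_n).
Implicit Types (f g : 'rV[R]_n -> R).

Local Notation e i := (delta_mx ord0 i : 'rV[R]_n).

(** Written so that t |-> shrink t x is visibly a line in direction [e i], as
[is_derive_line] requires. *)
Definition shrink (t : R) (x : 'rV[R]_n) : 'rV[R]_n :=
  (t * x ord0 i) *: e i + (x - x ord0 i *: e i).

Lemma shrinkE t x j : shrink t x ord0 j = (if j == i then t else 1) * x ord0 j.
Proof.
rewrite !mxE eqxx /=; case: eqP => [->|_]; first by rewrite !mulr1 subrr addr0.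
by rewrite !mulr0 subr0 add0r mul1r.
Qed.

Lemma shrink1 x : shrink 1 x = x.
Proof. by apply/rowP => j; rewrite shrinkE; case: ifP; rewrite mul1r. Qed.

Hypothesis oQ : open Q.
Hypothesis shrinkQ : forall t x, 0 <= t <= 1 -> Q x -> Q (shrink t x).

Lemma shrink_continuous : continuous (fun z : R * 'rV[R]_n => shrink z.1 z.2).
Proof.
move=> z; apply: continuous_rV => j.
have -> : (fun y : R * 'rV[R]_n => shrink y.1 y.2 ord0 j) =
    (fun y => (if j == i then y.1 else 1) * y.2 ord0 j).
  by apply/funext => y; rewrite shrinkE.
apply: (@continuousM R (R * 'rV[R]_n)%type (fun z => if j == i then z.1 else 1) (fun z => z.2 ord0 j)).
  by case: (j == i); [exact: cvg_fst|exact: cvg_cst].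
apply: (@continuous_comp _ _ _ (fun z : R * 'rV[R]_n => z.2) (fun x => x ord0 j)).
  exact: cvg_snd.
exact: coord_continuous.
Qed.

(** Tube lemma: continuity in [x] is uniform in the parameter [t] of the
compact interval [0, 1]. *)
Lemma shrink_tube f (a : 'rV[R]_n) (eps : R) : (forall x, Q x -> {for x, continuous f}) ->
  Q a -> 0 < eps ->
  \forall x \near a, forall t, 0 <= t <= 1 -> `|f (shrink t x) - f (shrink t a)| <= eps.
Proof.
move=> cf Qa eps0.
have /compact_near_coveringP/(_ _ (nbhs a)
    (fun x t => `|f (shrink t x) - f (shrink t a)| <= eps) (nbhs_filter a)) :=
  @segment_compact R 0 1.
have H : forall t : R, `[0, 1]%classic t ->
    \forall t' \near t & x \near a, `|f (shrink t' x) - f (shrink t' a)| <= eps.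
  move=> t; rewrite /= in_itv/= => t01.
  have cft : {for (t, a), continuous (fun z : R * 'rV[R]_n => f (shrink z.1 z.2))}.
    apply: (@continuous_comp _ _ _ (fun z : R * 'rV[R]_n => shrink z.1 z.2) f).
      exact: shrink_continuous.
    by apply: cf; exact: shrinkQ.
  have eps20 : 0 < eps / 2 by rewrite divr_gt0.
  have := (@cvgrPdist_le R R^o _ _ (nbhs_filter (t, a)) _ _).1 cft _ eps20.
  case=> [[A B]] /= [tA aB] AB.
  exists (A, B) => //= -[s x] /= [As Bx].
  apply: (@dist_halves _ _ _ (f (shrink t a))); rewrite distrC.
    exact: (AB (s, x)).
  by apply: (AB (s, a)); split=> //=; exact: nbhs_singleton aB.
move=> /(_ H); apply: filterS => x Hx t t01.
by apply: Hx; rewrite /= in_itv.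
Qed.

Lemma shrink_cont01 f x : (forall x, Q x -> {for x, continuous f}) -> Q x ->
  cont01 (fun t => f (shrink t x)).
Proof.
move=> cf Qx t t01; apply: (@continuous_comp _ _ _ (fun t => shrink t x) f).
  apply: (@continuous_comp _ _ _ (fun t : R => (t, x)) (fun z => shrink z.1 z.2)).
    apply: (@cvg_pair _ _ _ (nbhs t) (nbhs t) (nbhs x) _ _ _ id (fun=> x)).
      exact: cvg_id.
    exact: cvg_cst.
  exact: shrink_continuous.
by apply: cf; exact: shrinkQ.
Qed.

(** For f = d_i h and m = 0 this is the quotient (h - h(x_i := 0)) / x_i; the
weight t^m appears when that quotient is differentiated [m] times in x_i. *)
Definition average (m : nat) f x : R := int01 (fun t => t ^+ m * f (shrink t x)).

Lemma average_le m f x S : (forall x, Q x -> {for x, continuous f}) -> Q x ->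
  (forall y, Q y -> `|f y| <= S) -> `|average m f x| <= S / m.+1%:R.
Proof.
move=> cf Qx fS; apply: int01_exp_le; first exact: shrink_cont01.
by move=> t t01; apply: fS; exact: shrinkQ.
Qed.

Lemma averageB m f g x y : cont01 (fun t => f (shrink t x)) -> cont01 (fun t => g (shrink t y)) ->
  average m f x - average m g y =
  int01 (fun t => t ^+ m * (f (shrink t x) - g (shrink t y))).
Proof.
move=> cf cg; rewrite /average -int01B; [|exact: cont01_expM..].
by apply: eq_int01 => t _; rewrite mulrBr.
Qed.

Lemma average_continuous m f : (forall x, Q x -> {for x, continuous f}) ->
  forall x, Q x -> {for x, continuous (average m f)}.
Proof.
move=> cf x Qx.
apply/(@cvgrPdist_le R R^o _ (nbhs x) (nbhs_filter x) (average m f) (average m f x)) => eps eps0.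
have := shrink_tube cf Qx eps0; have := open_near oQ Qx.
apply: filterS2 => y Qy Hy.
have cx := shrink_cont01 cf Qx; have cy := shrink_cont01 cf Qy.
rewrite (averageB _ cx cy) (le_trans (int01_exp_le _ _ (S := eps) _)) //.
- by move=> t t01; apply: (@continuousB _ R^o); [exact: cx|exact: cy].
- by move=> t t01; rewrite distrC; exact: Hy.
by rewrite ler_pdivrMr ?ltr0n // ler_peMr ?(ltW eps0) // ler1n.
Qed.

Lemma partial_coord (j l : 'I_n) (x : 'rV[R]_n) :
  'D_(e j) (fun y : 'rV[R]_n => y ord0 l) x = (l == j)%:R.
Proof.
have did : differentiable (id : 'rV[R]_n -> 'rV[R]_n) x by [].
have := derive_coord (e j) l did; rewrite diff_val /= => <-.
by rewrite mxE eqxx.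
Qed.

Lemma partial_shrink f t x j : smooth_on Q f -> 0 <= t <= 1 -> Q x ->
  derivable (f \o shrink t) x (e j) /\
  partial j (f \o shrink t) x = (if j == i then t else 1) * partial j f (shrink t x).
Proof.
move=> sf t01 Qx.
have cE l : (fun y => shrink t y ord0 l) = (fun y => (if l == i then t else 1) * y ord0 l).
  by apply/funext => y; rewrite shrinkE.
have dc l y : differentiable (fun y : 'rV[R]_n => y ord0 l) y.
  exact: differentiable_coord.
have ds y : differentiable (shrink t) y.
  apply: differentiable_rV => l; rewrite cE.
  by apply: differentiableM.
have df : differentiable f (shrink t x).
  by apply: (smooth_differentiable oQ sf); exact: shrinkQ.
split; first by apply: diff_derivable; apply: differentiable_comp.
rewrite chain_rule // (bigD1 j) //= big1 ?addr0.
  rewrite mulrC; congr (_ * _); rewrite cE /partial deriveMl; last exact: diff_derivable.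
  by rewrite partial_coord eqxx mulr1.
move=> l lj; rewrite cE /partial deriveMl; last exact: diff_derivable.
by rewrite partial_coord (negPf lj) !mulr0.
Qed.

(** Differentiation under the integral sign.  The chain rule multiplies the
integrand by [t] exactly when the derivative is taken in direction [i], which
raises the exponent of the density by one. *)
Lemma average_derive (m : nat) f x j : smooth_on Q f -> Q x ->
  derivable (average m f) x (e j) /\
  partial j (average m f) x = average (m + (j == i)) (partial j f) x.
Proof.
move=> sf Qx.
have cf y : Q y -> {for y, continuous f} by move=> /(sf [::])[].
have cpf y : Q y -> {for y, continuous (partial j f)} by move=> /(sf [:: j])[].
suff : h^-1 *: ((average m f \o shift x) (h *: e j) - average m f x) @[h --> 0^'] -->
    average (m + (j == i)) (partial j f) x.
  move=> H; split; first by apply/cvg_ex; eexists; exact: H.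
  exact: cvg_lim H.
have FF : Filter (0 : R)^' by exact: dnbhs_filter.
apply/(@cvgrPdist_le R R^o _ _ FF) => eps eps0.
have /nbhs_ballP[d /= d0 dB] : \forall y \near x, Q y /\
    forall t, 0 <= t <= 1 -> `|partial j f (shrink t y) - partial j f (shrink t x)| <= eps.
  by apply: filterS2 (open_near oQ Qx) (shrink_tube cpf Qx eps0) => y Qy Hy.
have [H1 H2] : (forall y, ball x d y -> Q y) /\ forall y, ball x d y ->
   forall t, 0 <= t <= 1 -> `|partial j f (shrink t y) - partial j f (shrink t x)| <= eps.
  by split=> y /dB[].
have lined (s : R) : `|s| < d -> ball x d (s *: e j + x).
  move=> sd; rewrite -ball_normE /= distrC addrK; apply: le_lt_trans sd.
  by rewrite normrZ ler_piMr // norm_delta_le1.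
near=> h.
have hd : `|h| < d by near: h; exact: dnbhs0_lt.
have hn0 : h != 0 by near: h; exact: nbhs_dnbhs_neq.
have Qh : Q (h *: e j + x) by apply/H1/lined.
pose c (t : R) : R := if j == i then t else 1.
have cc : cont01 c by rewrite /c; case: (j == i) => t _; [exact: cvg_id|exact: cvg_cst].
have -> : average (m + (j == i)) (partial j f) x =
    int01 (fun t => t ^+ m * (c t * partial j f (shrink t x))).
  apply: eq_int01 => t _; rewrite exprD mulrA; congr (_ * _ * _).
  by rewrite /c; case: eqP; rewrite ?expr1 ?expr0.
have ch := shrink_cont01 cf Qh; have cx := shrink_cont01 cf Qx.
have cd : cont01 (fun t => f (shrink t (h *: e j + x)) - f (shrink t x)).
  by move=> t t01; apply: (@continuousB _ R^o); [exact: ch|exact: cx].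
have cp : cont01 (fun t => c t * partial j f (shrink t x)).
  by move=> t t01; apply: continuousM; [exact: cc|exact: (shrink_cont01 cpf Qx)].
have -> : h^-1 *: ((average m f \o shift x) (h *: e j) - average m f x) =
    int01 (fun t => h^-1 * (t ^+ m * (f (shrink t (h *: e j + x)) - f (shrink t x)))).
  rewrite int01Z; last exact: cont01_expM.
  by rewrite -(averageB m ch cx).
rewrite -int01B; [|exact: cont01_expM|]; last first.
  move=> t t01; apply: continuousM; first exact: cst_continuous.
  exact: (cont01_expM cd).
rewrite (@eq_int01 _ _ (fun t => t ^+ m * (c t * partial j f (shrink t x) -
   h^-1 * (f (shrink t (h *: e j + x)) - f (shrink t x))))); last first.
  by move=> t _; ring.
apply: le_trans (int01_exp_le _ _ (S := eps) _) _.
- move=> t t01; apply: (@continuousB _ R^o); first exact: cp.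
  by apply: continuousM; [exact: cst_continuous|exact: cd].
- move=> t t01.
  have dl s : `|s| <= `|h| -> derivable (f \o shrink t) (s *: e j + x) (e j).
    move=> sh; have Qs : Q (s *: e j + x) by apply/H1/lined; exact: le_lt_trans hd.
    by have [] := partial_shrink j sf t01 Qs.
  have [s sh sE] := line_mvt dl.
  have bs := lined _ (le_lt_trans sh hd).
  have [_ pE] := partial_shrink j sf t01 (H1 _ bs).
  have -> : f (shrink t (h *: e j + x)) - f (shrink t x) =
      h * (c t * partial j f (shrink t (s *: e j + x))).
    by apply: etrans sE _; congr (h * _); exact: pE.
  rewrite mulKf // -mulrBr normrM -[leRHS]mul1r ler_pM //.
    rewrite /c; case: ifP => _; last by rewrite normr1.
    by case/andP: t01 => t0 t1; rewrite ger0_norm.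
  by rewrite distrC; exact: H2.
by rewrite ler_pdivrMr ?ltr0n // ler_peMr ?(ltW eps0) // ler1n.
Unshelve. all: by end_near. Qed.

Lemma average_smooth m f : smooth_on Q f -> smooth_on Q (average m f).
Proof.
move=> sf; apply/smooth_Ck => k; elim: k m f sf => [|k IH] m f sf;
  have ca : forall x, Q x -> {for x, continuous (average m f)}
    by apply: average_continuous => x /(sf [::])[].
  by [].
split=> // j; split=> [x Qx|]; first by have [] := average_derive m j sf Qx.
have := IH (m + (j == i))%N _ (@smooth_partials _ _ _ _ [:: j] sf).
apply: Ck_congr => // x Qx.
by have [_ ->] := average_derive m j sf Qx.
Qed.

Lemma average_partials m f s : smooth_on Q f -> forall x, Q x ->
  partials s (average m f) x = average (m + count_mem i s) (partials s f) x.
Proof.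
move=> sf; elim: s => [|j s IH] x Qx; first by rewrite /= addn0.
apply: etrans (partial_congr oQ IH j Qx) _.
have [_ E] := average_derive (m + count_mem i s) j (@smooth_partials _ _ _ _ s sf) Qx.
by apply: etrans E _; rewrite /= addnCA addnA addnC addnA.
Qed.

(** Fundamental theorem of calculus along the segment t |-> shrink t x. *)
Lemma average_FTC f x : smooth_on Q f -> Q x ->
  x ord0 i * average 0 (partial i f) x = f x - f (shrink 0 x).
Proof.
move=> sf Qx; have cpf y : Q y -> {for y, continuous (partial i f)} by move=> /(sf [:: i])[].
have cp := shrink_cont01 cpf Qx.
apply: (etrans (esym (int01Z (x ord0 i) (cont01_expM (m := 0) cp)))).
apply: (@etrans _ _ (f (shrink 1 x) - f (shrink 0 x))); last by rewrite shrink1.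
apply: (@int01_FTC _ (fun t => f (shrink t x))); last first.
  by move=> t t01; apply: continuousM; [exact: cst_continuous|exact: (cont01_expM cp)].
move=> t t01; rewrite expr0 mul1r.
pose v := x ord0 i *: e i; pose y := x - x ord0 i *: e i.
have E s : shrink s x = s *: v + y by rewrite /shrink scalerA.
have -> : (fun s => f (shrink s x)) = (fun s => f (s *: v + y)).
  by apply/funext => s; rewrite E.
have df : differentiable f (t *: v + y).
  by rewrite -E; apply: (smooth_differentiable oQ sf); exact: shrinkQ.
have [d1 d2] := is_derive_line (@diff_derivable _ _ _ f _ v df).
split; first exact: d1.
by apply: etrans d2 _; rewrite E deriveE // linearZ /partial -deriveE.
Qed.

(** Off the hyperplane x_i = 0 both sides are f / x_i, as f vanishes on the
hyperplane; on the hyperplane they agree by continuity. *)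
Lemma hadamard_division f k : smooth_on Q f ->
  (forall x, Q x -> {for x, continuous k}) ->
  (forall x, Q x -> f x = x ord0 i * k x) ->
  forall x, Q x -> k x = average 0 (partial i f) x.
Proof.
move=> sf ck fE.
have f0 x : Q x -> f (shrink 0 x) = 0.
  move=> Qx; rewrite fE ?shrinkE ?eqxx ?mul0r //.
  by apply: shrinkQ; rewrite ?lexx ?ler01.
have eq_off x : Q x -> x ord0 i != 0 -> k x = average 0 (partial i f) x.
  move=> Qx xi; apply: (mulfI xi); rewrite -fE //.
  by rewrite average_FTC // f0 // subr0.
move=> x Qx; have [xi|] := eqVneq (x ord0 i) 0; last exact: eq_off.
have ca : {for x, continuous (average 0 (partial i f))}.
  by apply: average_continuous => // y /(sf [:: i])[].
apply/eqP; rewrite -subr_eq0 -normr_eq0; apply/eqP/le_anti; rewrite normr_ge0 andbT.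
apply/ler_addgt0Pl => eps eps0; rewrite addr0.
have eps20 : 0 < eps / 2 by rewrite divr_gt0.
have n1 := (@cvgrPdist_le R R^o _ _ (nbhs_filter x) _ _).1 (ck x Qx) _ eps20.
have n2 := (@cvgrPdist_le R R^o _ _ (nbhs_filter x) _ _).1 ca _ eps20.
have /nbhs_ballP[d /= d0 dB] : \forall y \near x, [/\ Q y, `|k x - k y| <= eps / 2 &
    `|average 0 (partial i f) x - average 0 (partial i f) y| <= eps / 2].
  by apply: filterS3 (open_near oQ Qx) n1 n2 => y.
have [Qy y1 y2] : [/\ Q ((d / 2) *: e i + x),
   `|k x - k ((d / 2) *: e i + x)| <= eps / 2 &
   `|average 0 (partial i f) x - average 0 (partial i f) ((d / 2) *: e i + x)| <= eps / 2].
  apply: dB; rewrite -ball_normE /= distrC addrK normrZ.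
  have d2 : `|d / 2| < d by rewrite gtr0_norm ?divr_gt0 //; lra.
  by apply: le_lt_trans d2; rewrite ler_piMr // norm_delta_le1.
have pi0 : ((d / 2) *: e i + x) ord0 i != 0.
  by rewrite !mxE !eqxx mulr1 xi addr0 gt_eqF // divr_gt0.
rewrite -(eq_off _ Qy pi0) in y2; exact: dist_halves y1 y2.
Qed.

End Hadamard.

(** * Leibniz formula and its estimates *)

Section Leibniz.
Variables (R : realType) (n : nat) (U : set 'rV[R]_n).
Hypothesis oU : open U.
Implicit Types (f g h : 'rV[R]_n -> R) (l : seq 'I_n) (ks js : seq nat).

Lemma smooth_congr f g : (forall x, U x -> f x = g x) -> smooth_on U f -> smooth_on U g.
Proof. by move=> fg /smooth_Ck sf; apply/smooth_Ck => k; exact: Ck_congr (sf k). Qed.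

Lemma smooth_cst (c : R) : smooth_on U (fun=> c).
Proof. by apply/smooth_Ck => k; exact: Ck_cst. Qed.

Lemma smooth_add f g : smooth_on U f -> smooth_on U g -> smooth_on U (fun x => f x + g x).
Proof. by move=> /smooth_Ck sf /smooth_Ck sg; apply/smooth_Ck => k; exact: Ck_add. Qed.

Lemma smooth_mul f g : smooth_on U f -> smooth_on U g -> smooth_on U (fun x => f x * g x).
Proof. by move=> /smooth_Ck sf /smooth_Ck sg; apply/smooth_Ck => k; exact: Ck_mul. Qed.

Lemma smooth_sum (I : Type) (r : seq I) (F : I -> 'rV[R]_n -> R) :
  (forall i, smooth_on U (F i)) -> smooth_on U (fun x => \sum_(i <- r) F i x).
Proof.
move=> sF; apply/smooth_Ck => k; apply: Ck_sum => // i.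
by move: (sF i) => /smooth_Ck.
Qed.

Lemma partials_add s f g : smooth_on U f -> smooth_on U g -> forall x, U x ->
  partials s (fun x => f x + g x) x = partials s f x + partials s g x.
Proof.
move=> sf sg; elim: s => [//|i s IH] x Ux.
apply: etrans (partial_congr oU IH i Ux) _.
have [_ df] := sf s x Ux; have [_ dg] := sg s x Ux.
exact: (deriveD (df i) (dg i)).
Qed.

Lemma partials_scale s (c : R) f : smooth_on U f -> forall x, U x ->
  partials s (fun x => c * f x) x = c * partials s f x.
Proof.
move=> sf; elim: s => [//|i s IH] x Ux.
apply: etrans (partial_congr oU IH i Ux) _.
have [_ df] := sf s x Ux.
exact: (deriveMl c (df i)).
Qed.

(** Derivatives divided by factorials are Taylor coefficients, for which the
Leibniz formula has no binomial coefficients. *)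
Definition divpartial i k f : 'rV[R]_n -> R := fun x => (k`!%:R)^-1 * partials (nseq k i) f x.

Lemma divpartial0 i f : divpartial i 0 f = f.
Proof. by apply/funext => x; rewrite /divpartial fact0 invr1 mul1r. Qed.

Lemma smooth_divpartial i k f : smooth_on U f -> smooth_on U (divpartial i k f).
Proof. by move=> sf; apply: smooth_mul; [exact: smooth_cst|exact: smooth_partials]. Qed.

Lemma divpartial_congr i k f g : (forall x, U x -> f x = g x) ->
  forall x, U x -> divpartial i k f x = divpartial i k g x.
Proof. by move=> fg x Ux; rewrite /divpartial (partials_congr oU fg). Qed.

Lemma divpartial_add i k f g : smooth_on U f -> smooth_on U g -> forall x, U x ->
  divpartial i k (fun x => f x + g x) x = divpartial i k f x + divpartial i k g x.
Proof. by move=> sf sg x Ux; rewrite /divpartial partials_add // mulrDr. Qed.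

Lemma partial_divpartial i k f x : smooth_on U f -> U x ->
  partial i (divpartial i k f) x = k.+1%:R * divpartial i k.+1 f x.
Proof.
move=> sf Ux; have sk := @smooth_partials _ _ _ _ (nseq k i) sf.
have [_ df] := sf (nseq k i) x Ux.
apply: etrans (deriveMl _ (df i)) _.
have E : (k`!%:R)^-1 = k.+1%:R * (k.+1`!%:R)^-1 :> R.
  by rewrite factS natrM invfM mulrA mulfV ?mul1r ?pnatr_eq0.
by rewrite E -mulrA.
Qed.

(** Differentiating the formula of order [k] produces each product of order
[k.+1] twice, with factors [j] and [k.+1 - j] that add up to [k.+1]. *)
Lemma divpartial_mul i k f g : smooth_on U f -> smooth_on U g -> forall x, U x ->
  divpartial i k (fun x => f x * g x) x =
  \sum_(j < k.+1) divpartial i j f x * divpartial i (k - j) g x.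
Proof.
move=> sf sg; elim: k => [|k IH] x Ux; first by rewrite big_ord1 subn0 !divpartial0.
have k0 : k.+1%:R != 0 :> R by rewrite pnatr_eq0.
apply: (mulfI k0); apply: etrans (esym (partial_divpartial i k (smooth_mul sf sg) Ux)) _.
apply: etrans (partial_congr oU IH i Ux) _.
have ds j h : smooth_on U h -> derivable (divpartial i j h) x (delta_mx ord0 i).
  by move=> sh; have [_ /(_ i)] := smooth_divpartial i j sh [::] Ux.
rewrite /partial (_ : (fun x => _) =
    \sum_(j < k.+1) (fun x => divpartial i j f x * divpartial i (k - j) g x));
  last by apply/funext => y; rewrite fct_sumE.
rewrite derive_sum; last by move=> j; apply: derivableM; exact: ds.
under eq_bigr => j _.
  rewrite (deriveM (ds _ _ sf) (ds _ _ sg)) -![_ *: _]/(_ * _).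
  rewrite -![derive _ _ _]/(partial i _ x) !partial_divpartial //.
  rewrite -subSn; last by rewrite -ltnS.
  rewrite mulrCA addrC [divpartial _ _ g x * _]mulrC -mulrA.
  over.
rewrite big_split /= mulr_sumr.
transitivity (\sum_(j < k.+2) (j%:R * (divpartial i j f x * divpartial i (k.+1 - j) g x) +
    (k.+1 - j)%:R * (divpartial i j f x * divpartial i (k.+1 - j) g x))).
  rewrite big_split /=; congr (_ + _).
    by rewrite [RHS]big_ord_recl mul0r add0r.
  by rewrite [RHS]big_ord_recr /= subnn mul0r addr0.
apply: eq_bigr => j _; rewrite -mulrDl -natrD subnKC //.
by rewrite -ltnS.
Qed.

(** The Taylor coefficient with exponent [k] in the direction [i], for the
corresponding entries [i] of [l] and [k] of [ks].  Treating the directions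
one after the other reduces the Leibniz formula to one variable. *)
Fixpoint taylor l ks f : 'rV[R]_n -> R :=
  match l, ks with
  | i :: l', k :: ks' => taylor l' ks' (divpartial i k f)
  | _, _ => f
  end.

Lemma taylor_congr l ks f g : (forall x, U x -> f x = g x) ->
  forall x, U x -> taylor l ks f x = taylor l ks g x.
Proof.
elim: l ks f g => [|i l IH] [|k ks] f g fg //=; apply: IH.
exact: divpartial_congr.
Qed.

Lemma taylor_add l ks f g : smooth_on U f -> smooth_on U g -> forall x, U x ->
  taylor l ks (fun x => f x + g x) x = taylor l ks f x + taylor l ks g x.
Proof.
elim: l ks f g => [|i l IH] [|k ks] f g sf sg x Ux //=.
apply: etrans (taylor_congr l ks (divpartial_add i k sf sg) Ux) _.
exact: (IH ks _ _ (smooth_divpartial i k sf) (smooth_divpartial i k sg) x Ux).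
Qed.

Lemma taylor_cst0 l ks x : U x -> taylor l ks (fun=> 0) x = 0.
Proof.
move=> Ux; have := taylor_add l ks (smooth_cst 0) (smooth_cst 0) Ux.
rewrite (_ : (fun=> _ + _) = fun=> 0 :> R); last by apply/funext => y; rewrite addr0.
by move/eqP; rewrite -subr_eq0 opprD addrA subrr sub0r oppr_eq0 => /eqP.
Qed.

Lemma taylor_sum l ks (I : Type) (r : seq I) (F : I -> 'rV[R]_n -> R) x :
  (forall i, smooth_on U (F i)) -> U x ->
  taylor l ks (fun x => \sum_(i <- r) F i x) x = \sum_(i <- r) taylor l ks (F i) x.
Proof.
move=> sF Ux; elim: r => [|i r IH].
  by rewrite big_nil -[RHS](taylor_cst0 l ks Ux); congr (taylor _ _ _ x); apply/funext => y; rewrite big_nil.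
rewrite big_cons -IH -taylor_add //; last exact: smooth_sum.
by congr (taylor _ _ _ x); apply/funext => y; rewrite big_cons.
Qed.

Lemma taylor_mul_cons i l k ks f g x : smooth_on U f -> smooth_on U g -> U x ->
  taylor (i :: l) (k :: ks) (fun x => f x * g x) x =
  \sum_(j < k.+1) taylor l ks (fun x => divpartial i j f x * divpartial i (k - j) g x) x.
Proof.
move=> sf sg Ux /=.
apply: etrans (taylor_congr l ks (divpartial_mul i k sf sg) Ux) _.
exact: (taylor_sum l ks _ (fun j : 'I_k.+1 =>
  smooth_mul (smooth_divpartial i j sf) (smooth_divpartial i (k - j) sg)) Ux).
Qed.

Lemma geometric_half (r : R) k : 0 <= r -> r <= 2^-1 -> \sum_(j < k) r ^+ j <= 2.
Proof.
move=> r0 r2; elim: k => [|k IH]; first by rewrite big_ord0.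
rewrite big_ord_recl expr0; under eq_bigr do rewrite exprS.
rewrite -mulr_sumr; have S0 : 0 <= \sum_(j < k) r ^+ j.
  by apply: sumr_ge0 => j _; exact: exprn_ge0.
by have := ler_pM r0 S0 r2 IH; lra.
Qed.

(** The one-variable convolution is bounded by a geometric series of ratio
[r <= 1/2] in each direction, whence the factor 2 per direction. *)
Lemma taylor_mul_le l ks f g x (A B0 H B r : R) (v w z : nat -> R) :
  smooth_on U f -> smooth_on U g -> U x -> size ks = size l ->
  0 <= A -> 0 <= H -> 0 <= B0 -> 0 <= B -> 0 <= r -> r <= 2^-1 -> B0 <= r * B ->
  (forall a b, 0 <= v a * w b <= z (a + b)%N) ->
  (forall js, all2 leq js ks -> `|taylor l js f x| <= A * B0 ^+ sumn js * v (sumn js)) ->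
  (forall js, all2 leq js ks -> `|taylor l js g x| <= H * B ^+ sumn js * w (sumn js)) ->
  `|taylor l ks (fun x => f x * g x) x| <= 2 ^+ size l * (A * H) * B ^+ sumn ks * z (sumn ks).
Proof.
move=> sf sg Ux + A0 H0 B00 B_0 r0 r2 B0B.
elim: l ks f g sf sg A H v w z A0 H0 => [|i l IH] [|k ks] // f g sf sg A H v w z A0 H0.
  move=> _ vw /(_ [::] isT) /= Hf /(_ [::] isT) /= Hg.
  rewrite expr0 !mul1r mulr1 normrM; rewrite !expr0 !mulr1 in Hf Hg.
  apply: le_trans (ler_pM _ _ Hf Hg) _; rewrite ?normr_ge0 // mulrACA.
  by rewrite ler_wpM2l ?mulr_ge0 //; have /andP[] := vw 0%N 0%N.
move=> [sz] vw Hf Hg; rewrite taylor_mul_cons //.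
have z0 m : 0 <= z m by have /andP[a b] := vw 0%N m; exact: le_trans b.
apply: le_trans (ler_norm_sum _ _ _) _.
have bound (j : 'I_k.+1) : `|taylor l ks (fun x => divpartial i j f x * divpartial i (k - j) g x) x| <=
   2 ^+ size l * (A * H) * B ^+ (k + sumn ks) * z (k + sumn ks)%N * r ^+ j.
  have jk : (j <= k)%N by rewrite -ltnS.
  have Aj : 0 <= A * B0 ^+ j by rewrite mulr_ge0 ?exprn_ge0.
  have Hj : 0 <= H * B ^+ (k - j) by rewrite mulr_ge0 ?exprn_ge0.
  have sfj := smooth_divpartial i j sf; have sgj := smooth_divpartial i (k - j) sg.
  have vwj a b : 0 <= v (j + a)%N * w (k - j + b)%N <= z (k + (a + b))%N.
    by have := vw (j + a)%N (k - j + b)%N; rewrite addnACA subnKC.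
  apply: le_trans (IH ks _ _ sfj sgj _ _ (fun a => v (j + a)%N)
    (fun b => w (k - j + b)%N) (fun m => z (k + m)%N) Aj Hj sz vwj _ _) _.
  - by move=> js jsk; have := Hf (nat_of_ord j :: js); rewrite /= jk exprD !mulrA; apply.
  - move=> js jsk; have := Hg ((k - j)%N :: js); rewrite /= leq_subr exprD !mulrA.
    by apply.
  cbv beta; rewrite [leLHS](_ : _ = (2 ^+ size l * (A * H) * B ^+ sumn ks * z (k + sumn ks)%N) *
    (B0 ^+ j * B ^+ (k - j))); last by move: (B ^+ (k - j)) => P; ring.
  rewrite [leRHS](_ : _ = (2 ^+ size l * (A * H) * B ^+ sumn ks * z (k + sumn ks)%N) *
    (B ^+ k * r ^+ j)); last by rewrite exprD; ring.
  rewrite ler_wpM2l ?mulr_ge0 ?exprn_ge0 //.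
  have -> : B ^+ k = B ^+ (k - j) * B ^+ j by rewrite -exprD subnK.
  rewrite -mulrA -exprMn mulrC ler_wpM2l ?exprn_ge0 //.
  by rewrite lerXn2r ?nnegrE ?mulr_ge0 // mulrC.
apply: le_trans (ler_sum _ (fun j _ => bound j)) _.
rewrite -mulr_sumr [sumn _]/= [size (_ :: _)]/= exprS.
rewrite [leRHS](_ : _ = (2 ^+ size l * (A * H) * B ^+ (k + sumn ks) * z (k + sumn ks)%N) * 2);
  last by ring.
by rewrite ler_wpM2l ?mulr_ge0 ?exprn_ge0 // geometric_half.
Qed.

(** The term of the Leibniz formula in which [f] is not differentiated is
singled out.  Each of the other ones has a factor [r], and involves only
coefficients of [g] strictly below [ks], which is what makes an induction on
the order possible when the product is known and [g] is sought. *)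
Lemma taylor_mul_err l ks f g x (A B0 H B r : R) (v w z : nat -> R) :
  smooth_on U f -> smooth_on U g -> U x -> size ks = size l ->
  0 <= A -> 0 <= H -> 0 <= B0 -> 0 <= B -> 0 <= r -> r <= 2^-1 -> B0 <= r * B ->
  (forall a b, 0 <= v a * w b <= z (a + b)%N) ->
  (forall js, all2 leq js ks -> `|taylor l js f x| <= A * B0 ^+ sumn js * v (sumn js)) ->
  (forall js, all2 leq js ks -> js != ks ->
     `|taylor l js g x| <= H * B ^+ sumn js * w (sumn js)) ->
  `|taylor l ks (fun x => f x * g x) x - f x * taylor l ks g x| <=
  2 * r * 2 ^+ size l * (A * H) * B ^+ sumn ks * z (sumn ks).
Proof.
move=> sf sg Ux + A0 H0 B00 B_0 r0 r2 B0B.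
elim: l ks f g sf sg A H v w z A0 H0 => [|i l IH] [|k ks] // f g sf sg A H v w z A0 H0.
  move=> _ vw _ _ /=; rewrite subrr normr0.
  have z0 m : 0 <= z m by have /andP[a b] := vw 0%N m; exact: le_trans b.
  by rewrite !mulr_ge0 ?exprn_ge0.
move=> [sz] vw Hf Hg; rewrite taylor_mul_cons //.
have z0 m : 0 <= z m by have /andP[a b] := vw 0%N m; exact: le_trans b.
(* In the first term f is not differentiated in the direction i: the induction
   hypothesis, applied to f and divpartial i k g, deals with it. *)
rewrite big_ord_recl subn0 divpartial0 addrAC.
apply: le_trans (ler_normD _ _) _.
set K := A * H * B ^+ (k + sumn ks) * z (k + sumn ks)%N.
have K0 : 0 <= K by rewrite !mulr_ge0 ?exprn_ge0.
have -> : 2 * r * 2 ^+ size (i :: l) * (A * H) * B ^+ sumn (k :: ks) * z (sumn (k :: ks)) =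
   2 * r * 2 ^+ size l * K + 2 ^+ size l * K * (2 * r) by rewrite /= exprS /K; ring.
apply: lerD.
  have vw0 a b : 0 <= v a * w (k + b)%N <= z (k + (a + b))%N.
    by have := vw a (k + b)%N; rewrite addnCA.
  have Hk : 0 <= H * B ^+ k by rewrite mulr_ge0 ?exprn_ge0.
  apply: le_trans (IH ks _ _ sf (smooth_divpartial i k sg) _ _ v
    (fun b => w (k + b)%N) (fun m => z (k + m)%N) A0 Hk sz vw0 _ _) _.
  - by move=> js jsk; have := Hf (0%N :: js); rewrite /= divpartial0; exact.
  - move=> js jsk jn; have := Hg (k :: js); rewrite /= leqnn exprD !mulrA.
    by apply=> //; rewrite eqseq_cons eqxx.
  by rewrite le_eqVlt; apply/orP; left; apply/eqP; rewrite /K exprD; ring.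
apply: le_trans (ler_norm_sum _ _ _) _.
have bound (j : 'I_k) :
    `|taylor l ks (fun x => divpartial i (lift ord0 j) f x *
        divpartial i (k - lift ord0 j) g x) x| <=
   2 ^+ size l * K * (r * r ^+ j).
  have jk : (lift ord0 j <= k)%N by rewrite lift0.
  set J := nat_of_ord (lift ord0 j) in jk *.
  have J0 : (0 < J)%N by rewrite /J lift0.
  have Aj : 0 <= A * B0 ^+ J by rewrite mulr_ge0 ?exprn_ge0.
  have Hj : 0 <= H * B ^+ (k - J) by rewrite mulr_ge0 ?exprn_ge0.
  have sfj := smooth_divpartial i J sf; have sgj := smooth_divpartial i (k - J) sg.
  have vwj a b : 0 <= v (J + a)%N * w (k - J + b)%N <= z (k + (a + b))%N.
    by have := vw (J + a)%N (k - J + b)%N; rewrite addnACA subnKC.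
  apply: le_trans (@taylor_mul_le l ks _ _ x _ _ _ _ _ (fun a => v (J + a)%N)
    (fun b => w (k - J + b)%N) (fun m => z (k + m)%N) sfj sgj Ux sz Aj Hj B00 B_0 r0 r2 B0B vwj _ _) _.
  - by move=> js jsk; have := Hf (J :: js); rewrite /= jk exprD !mulrA; apply.
  - move=> js jsk; have := Hg ((k - J)%N :: js); rewrite /= leq_subr exprD !mulrA.
    apply=> //; rewrite eqseq_cons negb_and; apply/orP; left.
    by rewrite neq_ltn ltn_subrL J0 (leq_trans J0 jk).
  cbv beta; rewrite [leLHS](_ : _ = (2 ^+ size l * (A * H) * B ^+ sumn ks * z (k + sumn ks)%N) *
    (B0 ^+ J * B ^+ (k - J))); last by move: (B ^+ (k - J)) => P; ring.
  rewrite [leRHS](_ : _ = (2 ^+ size l * (A * H) * B ^+ sumn ks * z (k + sumn ks)%N) *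
    (B ^+ k * r ^+ J)); last by rewrite /K /J lift0 exprS exprD; ring.
  rewrite ler_wpM2l ?mulr_ge0 ?exprn_ge0 //.
  have -> : B ^+ k = B ^+ (k - J) * B ^+ J by rewrite -exprD subnK.
  rewrite -mulrA -exprMn mulrC ler_wpM2l ?exprn_ge0 //.
  by rewrite lerXn2r ?nnegrE ?mulr_ge0 // mulrC.
apply: le_trans (ler_sum _ (fun j _ => bound j)) _.
rewrite -mulr_sumr ler_wpM2l ?mulr_ge0 ?exprn_ge0 // -mulr_sumr mulrC.
by rewrite ler_wpM2r // geometric_half.
Qed.

End Leibniz.

(** * Majorants and their behaviour under the operations of the calculus *)

Section Majorants.
Variables (R : realType) (n : nat).
Implicit Types (f g h : 'rV[R]_n -> R) (U : set 'rV[R]_n) (a b : mindex n) (v w z : nat -> R).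

(** The order of differentiation used by [mpartial]. *)
Definition mindex_seq a : seq 'I_n := flatten [seq nseq (a i) i | i <- enum 'I_n].

Lemma count_mindex_seq a i : count_mem i (mindex_seq a) = a i.
Proof.
rewrite /mindex_seq count_flatten -map_comp sumnE big_map big_enum /= (bigD1 i) //=.
rewrite count_nseq /= eqxx mul1n big1 ?addn0 // => j ji.
by rewrite count_nseq /= (negPf ji).
Qed.

Lemma size_mindex_seq a : size (mindex_seq a) = mdeg a.
Proof.
rewrite /mindex_seq size_flatten /shape -map_comp sumnE big_map big_enum /=.
by apply: eq_bigr => i _; rewrite /= size_nseq.
Qed.

Definition mindex0 : mindex n := [ffun=> 0%N].

Definition mindex_incr a i : mindex n := [ffun j => (a j + (j == i))%N].

Lemma mdeg_incr a i : mdeg (mindex_incr a i) = (mdeg a).+1.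
Proof.
rewrite /mdeg (eq_bigr (fun j => a j + (j == i))%N); last by move=> j _; rewrite ffunE.
rewrite big_split /= -addn1; congr (_ + _)%N.
by rewrite (bigD1 i) //= eqxx big1 // => j /negPf->.
Qed.

Lemma mfact_incr a i : mfact (mindex_incr a i) = ((a i).+1 * mfact a)%N.
Proof.
rewrite /mfact (bigD1 i) // [in RHS](bigD1 i) //= ffunE eqxx addn1 factS mulnA.
by congr (_ * _)%N; apply: eq_bigr => j /negPf ji; rewrite ffunE ji addn0.
Qed.

Lemma mpartial_incr U f a i x : open U -> smooth_on U f -> U x ->
  mpartial a (partial i f) x = mpartial (mindex_incr a i) f x.
Proof.
move=> oU sf Ux.
apply: etrans (esym (congr1 (@^~ x) (partials_cat (mindex_seq a) [:: i] f))) _.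
apply: (partials_perm oU sf _ Ux); apply/allP => j _ /=; apply/eqP.
by rewrite count_cat -/(mindex_seq _) !count_mindex_seq ffunE /= addn0 eq_sym.
Qed.

Lemma mfact_gt0 a : (0 < mfact a)%N.
Proof. by rewrite prodn_gt0 // => i; exact: fact_gt0. Qed.

Lemma taylor_mapE U (l : seq 'I_n) (a : 'I_n -> nat) f x : open U -> smooth_on U f -> U x ->
  taylor l (map a l) f x =
  ((\prod_(i <- l) (a i)`!)%N%:R)^-1 *
  partials (flatten (rev [seq nseq (a i) i | i <- l])) f x.
Proof.
move=> oU; elim: l f => [|i l IH] f sf Ux; first by rewrite big_nil invr1 mul1r.
apply: etrans (IH _ (smooth_divpartial oU i (a i) sf) Ux) _.
rewrite /= rev_cons flatten_rcons partials_cat.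
have sp := @smooth_partials _ _ _ _ (nseq (a i) i) sf.
rewrite (partials_scale oU _ _ sp Ux) mulrA; congr (_ * _).
by rewrite big_cons natrM invfM mulrC.
Qed.

(** [taylor] takes the directions in the opposite order, which is harmless by
[partials_perm]. *)
Lemma mpartial_taylor U a f x : open U -> smooth_on U f -> U x ->
  mpartial a f x = (mfact a)%:R * taylor (enum 'I_n) (map a (enum 'I_n)) f x.
Proof.
move=> oU sf Ux; rewrite (taylor_mapE _ _ oU sf Ux).
have -> : mfact a = (\prod_(i <- enum 'I_n) (a i)`!)%N by rewrite big_enum.
rewrite mulVKf; last by rewrite pnatr_eq0 -lt0n prodn_gt0 // => i; exact: fact_gt0.
apply: (partials_perm oU sf _ Ux); apply: perm_flatten.
by rewrite perm_sym perm_rev.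
Qed.

Lemma sumn_mindex a : sumn (map a (enum 'I_n)) = mdeg a.
Proof. by rewrite sumnE big_map big_enum. Qed.

Lemma mindex_of_seq (js : seq nat) : size js = n ->
  exists a, js = map a (enum 'I_n).
Proof.
move=> sj; exists [ffun i : 'I_n => nth 0%N js i].
apply: (@eq_from_nth _ 0%N) => [|i]; first by rewrite size_map size_enum_ord.
rewrite sj => ij; rewrite (nth_map (Ordinal ij)) ?size_enum_ord // ffunE.
by rewrite nth_enum_ord.
Qed.

(** The estimate of [DC_bounds], with the constants as parameters. *)
Definition majorized U f (A B : R) w := forall a x, U x ->
  `|mpartial a f x| <= A * B ^+ mdeg a * (mfact a)%:R * w (mdeg a).

Lemma majorized_norm U f A B w x : majorized U f A B w -> U x -> `|f x| <= A * w 0%N.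
Proof.
move=> Hf Ux; have := Hf mindex0 x Ux.
have deg0 : mdeg mindex0 = 0%N by rewrite /mdeg big1 // => i _; rewrite ffunE.
have fact0 : mfact mindex0 = 1%N by rewrite /mfact big1 // => i _; rewrite ffunE.
have seq0 : mindex_seq mindex0 = [::] by apply/nilP; rewrite /nilp size_mindex_seq deg0.
by rewrite /mpartial -/(mindex_seq _) seq0 deg0 fact0 expr0 !mulr1.
Qed.

Lemma majorized_taylor U f A B w : open U -> smooth_on U f ->
  majorized U f A B w <-> forall js x, U x -> size js = n ->
    `|taylor (enum 'I_n) js f x| <= A * B ^+ sumn js * w (sumn js).
Proof.
move=> oU sf; have P a : 0 < (mfact a)%:R :> R by rewrite ltr0n mfact_gt0.
split=> H.
  move=> js x Ux /mindex_of_seq[a ->]; have := H a x Ux.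
  rewrite (mpartial_taylor _ oU sf Ux) normrM gtr0_norm // sumn_mindex.
  by rewrite mulrAC [_ * (mfact a)%:R]mulrC ler_pM2l.
move=> a x Ux; rewrite (mpartial_taylor _ oU sf Ux) normrM gtr0_norm // mulrAC [leRHS]mulrC ler_pM2l //.
by rewrite -sumn_mindex; apply: H => //; rewrite size_map size_enum_ord.
Qed.

Lemma all2_leq_size (js ks : seq nat) : all2 leq js ks -> size js = size ks.
Proof. by elim: js ks => [|j js IH] [|k ks] //= /andP[_ /IH ->]. Qed.

Lemma all2_leq_sumn (js ks : seq nat) : all2 leq js ks -> js != ks ->
  (sumn js < sumn ks)%N.
Proof.
have le_sumn : forall js ks, all2 leq js ks -> (sumn js <= sumn ks)%N.
  by elim=> [|j js' IH] [|k ks'] //= /andP[jk /IH]; exact: leq_add.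
elim: js ks => [|j js IH] [|k ks] //= /andP[jk jsk].
rewrite eqseq_cons negb_and => /orP[jn|/(IH _ jsk)].
  by rewrite -addSn leq_add ?le_sumn // ltn_neqAle jn.
by rewrite -addnS; exact: leq_add.
Qed.

Lemma majorized_congr U f g A B w : open U -> (forall x, U x -> f x = g x) ->
  majorized U f A B w -> majorized U g A B w.
Proof.
move=> oU fg H a x Ux; have := H a x Ux.
by rewrite /mpartial (partials_congr oU fg _ Ux).
Qed.

Lemma majorized_mul U f g A B0 H B v w z : open U -> smooth_on U f -> smooth_on U g ->
  0 <= A -> 0 <= H -> 0 <= B0 -> 2 * B0 <= B ->
  (forall i j, 0 <= v i * w j <= z (i + j)%N) ->
  majorized U f A B0 v -> majorized U g H B w ->
  majorized U (fun x => f x * g x) (2 ^+ n * (A * H)) B z.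
Proof.
move=> oU sf sg A0 H0 B00 BB vw.
move=> /(majorized_taylor _ _ _ oU sf) Hf /(majorized_taylor _ _ _ oU sg) Hg.
apply/(majorized_taylor _ _ _ oU (smooth_mul oU sf sg)) => ks x Ux sk.
have B_0 : 0 <= B by apply: le_trans BB; rewrite mulr_ge0.
have r0 : 0 <= 2^-1 :> R by rewrite invr_ge0.
have BB' : B0 <= 2^-1 * B by lra.
have se : size ks = size (enum 'I_n) by rewrite size_enum_ord.
have := @taylor_mul_le _ _ U oU (enum 'I_n) ks f g x A B0 H B 2^-1 v w z sf sg Ux se A0 H0
  B00 B_0 r0 (lexx _) BB' vw.
rewrite size_enum_ord; apply => js /all2_leq_size sj.
  by apply: Hf => //; rewrite sj.
by apply: Hg => //; rewrite sj.
Qed.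

(** The majorant of [f] is fixed and [B] is large with respect to it, so [r] can
be taken small: the terms of the Leibniz formula that contain lower
derivatives of [g] contribute at most half of the bound on [g], multiplied by
[c]. *)
Lemma majorized_quotient U f g A B0 H B v w (c C r : R) : open U ->
  smooth_on U f -> smooth_on U g ->
  0 <= A -> 0 <= H -> 0 <= B0 -> 0 <= B -> 0 < c -> 0 <= r -> r <= 2^-1 ->
  B0 <= r * B -> (forall i, 0 <= v i) -> (forall i, 0 <= w i) ->
  (forall i j, v i * w j <= C * w (i + j)%N) -> 0 <= C ->
  2 * r * 2 ^+ n * A * C <= c / 2 ->
  (forall x, U x -> c <= `|f x|) ->
  majorized U f A B0 v -> majorized U (fun x => f x * g x) H B w ->
  majorized U g (2 * H / c) B w.
Proof.
move=> oU sf sg A0 H0 B00 B_0 c0 r0 r2 B0B v0 w0 vw C0 small fc.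
move=> /(majorized_taylor _ _ _ oU sf) Hf /(majorized_taylor _ _ _ oU (smooth_mul oU sf sg)) Hfg.
apply/(majorized_taylor _ _ _ oU sg) => ks x Ux.
(* Induction on the total order, as smaller exponents in the sense of all2 leq
   have a smaller sum. *)
have [m] := ubnP (sumn ks); elim: m ks => // m IH ks ksm sk.
have se : size ks = size (enum 'I_n) by rewrite size_enum_ord.
have H'0 : 0 <= 2 * H / c by rewrite divr_ge0 ?mulr_ge0 // ltW.
have vw' i j : 0 <= v i * w j <= C * w (i + j)%N by rewrite vw mulr_ge0.
have := @taylor_mul_err _ _ U oU (enum 'I_n) ks f g x A B0 (2 * H / c) B r v w (fun i => C * w i)
  sf sg Ux se A0 H'0 B00 B_0 r0 r2 B0B vw'.
rewrite size_enum_ord => err.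
have {}err := err (fun js jk => Hf js x Ux (etrans (all2_leq_size jk) sk)).
have {}err := err (fun js jk jn => IH js (leq_trans (all2_leq_sumn jk jn) ksm)
    (etrans (all2_leq_size jk) sk)).
set T := taylor _ ks g x in err *.
have main := Hfg ks x Ux sk; set P := taylor _ ks _ x in err main.
set Y := B ^+ sumn ks * w (sumn ks).
have Y0 : 0 <= Y by rewrite mulr_ge0 ?exprn_ge0.
have errY : `|P - f x * T| <= H * Y.
  apply: le_trans err _.
  rewrite [leLHS](_ : _ = (2 * r * 2 ^+ n * A * C) * ((2 * H / c) * Y)); last by rewrite /Y; ring.
  apply: (@le_trans _ _ ((c / 2) * ((2 * H / c) * Y))).
    by rewrite ler_wpM2r // mulr_ge0.
  rewrite (_ : c / 2 * (2 * H / c * Y) = H * Y) //; field; exact: lt0r_neq0.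
have mainY : `|P| <= H * Y by rewrite /Y mulrA.
have fT : `|f x| * `|T| <= 2 * H * Y.
  rewrite -normrM -[f x * T](subKr P); apply: le_trans (ler_normB _ _) _.
  by have := lerD mainY errY; lra.
have cT : c * `|T| <= 2 * H * Y by apply: le_trans fT; rewrite ler_wpM2r // fc.
rewrite -mulrA -/Y; rewrite mulrC in cT; rewrite -ler_pdivlMr // in cT.
by rewrite mulrAC.
Qed.

(** The factor [k.+1] dominates (a+e_i)! / a! = a_i + 1 for every direction
[i]. *)
Lemma majorized_partial U f i H B B' D w : open U -> smooth_on U f ->
  0 <= H -> 0 <= B -> (forall k, 0 <= w k) ->
  (forall k, k.+1%:R * B ^+ k.+1 <= D * B' ^+ k) ->
  majorized U f H B w ->
  majorized U (partial i f) (H * D) B' (fun k => w k.+1).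
Proof.
move=> oU sf H0 B0 w0 BB Hf a x Ux.
rewrite (mpartial_incr _ _ oU sf Ux).
apply: le_trans (Hf (mindex_incr a i) x Ux) _; rewrite mdeg_incr mfact_incr.
rewrite ler_wpM2r // natrM.
rewrite [leRHS](_ : _ = H * (D * B' ^+ mdeg a) * (mfact a)%:R); last by ring.
rewrite mulrA ler_wpM2r // -mulrA ler_wpM2l //.
apply: le_trans (BB _); rewrite mulrC ler_wpM2r ?exprn_ge0 // ler_nat ltnS.
by rewrite /mdeg (bigD1 i) //= leq_addr.
Qed.

(** (a+e_i)! = (a_i+1) a!, and a_i + 1 is also the inverse of the integral of
t^(a_i), so both cancel. *)
Lemma majorized_division U i f k H B w : open U ->
  (forall t x, 0 <= t <= 1 -> U x -> U (shrink i t x)) ->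
  smooth_on U f -> (forall x, U x -> {for x, continuous k}) ->
  (forall x, U x -> f x = x ord0 i * k x) ->
  majorized U f H B w ->
  smooth_on U k /\ majorized U k (H * B) B (fun j => w j.+1).
Proof.
move=> oU sU sf ck fE Hf.
have spf : smooth_on U (partial i f) := @smooth_partials _ _ _ _ [:: i] sf.
have kE x : U x -> average i 0 (partial i f) x = k x.
  by move=> Ux; rewrite (hadamard_division oU sU sf ck fE Ux).
have sa := average_smooth oU sU 0 spf.
split; first exact: smooth_congr kE sa.
apply: (majorized_congr oU kE) => a x Ux.
rewrite /mpartial (average_partials oU sU 0 _ spf Ux) add0n -!/(mindex_seq _) count_mindex_seq.
have cp y : U y -> {for y, continuous (partials (mindex_seq a) (partial i f))}.
  by move=> /(spf (mindex_seq a))[].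
have bound y : U y -> `|partials (mindex_seq a) (partial i f) y| <=
    H * B ^+ (mdeg a).+1 * ((a i).+1 * mfact a)%:R * w (mdeg a).+1.
  move=> Uy; have := Hf (mindex_incr a i) y Uy; rewrite mdeg_incr mfact_incr.
  by rewrite -(mpartial_incr a i oU sf Uy).
apply: le_trans (average_le sU (a i) cp Ux bound) _.
rewrite natrM exprS le_eqVlt; apply/orP; left; apply/eqP.
by field; rewrite addrC natr1 pnatr_eq0.
Qed.

Lemma coord_prod_continuous (r : seq 'I_n) :
  continuous (fun x : 'rV[R]_n => \prod_(i <- r) x ord0 i : R).
Proof.
move=> x; elim: r => [|j r IHr].
  rewrite (_ : (fun _ => _) = fun=> 1 : R); first exact: cst_continuous.
  by apply/funext => y; rewrite big_nil.
rewrite (_ : (fun _ => _) = (fun y : 'rV[R]_n => y ord0 j * \prod_(i <- r) y ord0 i)).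
  by apply: continuousM; [exact: coord_continuous|exact: IHr].
by apply/funext => y; rewrite big_cons.
Qed.

Lemma majorized_division_seq U (l : seq 'I_n) f k H B w : open U ->
  (forall i, i \in l -> forall t x, 0 <= t <= 1 -> U x -> U (shrink i t x)) ->
  smooth_on U f -> (forall x, U x -> {for x, continuous k}) ->
  (forall x, U x -> f x = (\prod_(i <- l) x ord0 i) * k x) ->
  majorized U f H B w ->
  smooth_on U k /\ majorized U k (H * B ^+ size l) B (fun j => w (j + size l)%N).
Proof.
move=> oU; elim: l f H w => [|i l IH] f H w sU sf ck fE Hf.
  have fk x : U x -> f x = k x by move=> /fE; rewrite big_nil mul1r.
  split; first exact: smooth_congr fk sf.
  rewrite mulr1 (_ : (fun j => w (j + 0)%N) = w); last by apply/funext => j; rewrite addn0.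
  exact: majorized_congr fk Hf.
pose k' (x : 'rV[R]_n) : R := (\prod_(i <- l) x ord0 i) * k x.
have ck' x : U x -> {for x, continuous k'}.
  by move=> Ux; apply: continuousM; [exact: coord_prod_continuous|exact: ck].
have fE' x : U x -> f x = x ord0 i * k' x.
  by move=> /fE ->; rewrite big_cons mulrA.
have [sk' Hk'] := majorized_division oU (sU i (mem_head _ _)) sf ck' fE' Hf.
have sU' j : j \in l -> forall t x, 0 <= t <= 1 -> U x -> U (shrink j t x).
  by move=> jl; apply: sU; rewrite inE jl orbT.
have [sk Hk] := IH k' _ _ sU' sk' ck (fun x _ => erefl) Hk'.
split=> //; rewrite /= exprS mulrA.
by rewrite (_ : (fun j => w (j + (size l).+1)%N) = (fun j => w (j + size l).+1)) //;
  apply/funext => j; rewrite addnS.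
Qed.

End Majorants.

(** * Log-convex weights *)

Section Weights.
Variables (R : realType) (M : nat -> R).
Hypothesis hM : DC_weight M.

Lemma weight_gt0 k : 0 < M k. Proof. by case: hM. Qed.
Lemma weight_ge0 k : 0 <= M k. Proof. exact/ltW/weight_gt0. Qed.

Lemma weight_ratio_le a b : (a <= b)%N -> M a.+1 / M a <= M b.+1 / M b.
Proof.
move=> /subnK <-; elim: (b - a)%N => [//|k IH]; apply: le_trans IH _.
by case: hM => _ /(_ (k + a)%N).
Qed.

(** The ratio M(a+c) / M(c) of two terms at distance [a] increases with [c]. *)
Lemma weight_mul a b c : (c <= b)%N -> M (a + c)%N * M b <= M c * M (a + b)%N.
Proof.
move=> cb; elim: a => [|a IH] //=.
have r1 := weight_ratio_le (leq_add (leqnn a) cb).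
have r0 : 0 <= M (a + c).+1 / M (a + c)%N by rewrite divr_ge0 ?weight_ge0.
have p0 : 0 <= M (a + c)%N * M b by rewrite mulr_ge0 ?weight_ge0.
have := ler_pM r0 p0 r1 IH.
rewrite !mulrA divfK ?gt_eqF ?weight_gt0 // => H; apply: le_trans H _.
by rewrite [_ * M c]mulrAC -mulrA [M c * _]mulrC !mulrA mulfVK ?gt_eqF ?weight_gt0 // mulrC.
Qed.

Lemma weight_shift_mul c q i j : (c <= q)%N ->
  M (i + c)%N * M (j + q)%N <= M c * M (i + j + q)%N.
Proof. by move=> cq; rewrite -addnA; apply: weight_mul; rewrite (leq_trans cq) ?leq_addl. Qed.

(** The ratios M(k+1) / M(k) are at least the first one. *)
Lemma weight_enlarge m k : (M 1 / M 0) ^+ m * M k <= M (m + k)%N.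
Proof.
elim: m => [|m IH]; first by rewrite expr0 mul1r.
have r1 := weight_ratio_le (leq0n (m + k)).
have r0 : 0 <= M 1 / M 0 by rewrite divr_ge0 ?weight_ge0.
have p0 : 0 <= (M 1 / M 0) ^+ m * M k by rewrite mulr_ge0 ?exprn_ge0 ?weight_ge0.
have := ler_pM r0 p0 r1 IH.
by rewrite divfK ?gt_eqF ?weight_gt0 // mulrA -exprS.
Qed.

End Weights.

(** * Algebras of majorized functions *)

Section Classes.
Variables (R : realType) (n : nat) (U : set 'rV[R]_n) (w : nat -> R) (C : R).
Hypotheses (oU : open U) (w0 : forall k, 0 < w k) (C0 : 0 <= C)
  (ww : forall i j, w i * w j <= C * w (i + j)%N).
Implicit Types (f g : 'rV[R]_n -> R).

Lemma majorizedW f (A A' B B' : R) : 0 <= A -> 0 <= B -> A <= A' -> B <= B' ->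
  majorized U f A B w -> majorized U f A' B' w.
Proof.
move=> A0 B0 AA BB Hf a x Ux; apply: le_trans (Hf a x Ux) _.
rewrite ler_wpM2r ?(ltW (w0 _)) // ler_wpM2r // ler_pM ?exprn_ge0 //.
by rewrite lerXn2r ?nnegrE // (le_trans B0).
Qed.

Lemma majorized_weight f (A B c : R) v v' : (forall k, v k <= c * v' k) -> 0 <= A -> 0 <= B ->
  majorized U f A B v -> majorized U f (A * c) B v'.
Proof.
move=> vv A0 B0 Hf a x Ux; apply: le_trans (Hf a x Ux) _.
apply: (@le_trans _ _ (A * B ^+ mdeg a * (mfact a)%:R * (c * v' (mdeg a)))).
  by rewrite ler_wpM2l // !mulr_ge0 ?exprn_ge0.
by rewrite le_eqVlt; apply/orP; left; apply/eqP; ring.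
Qed.

Lemma majorized_add f g (A A' B : R) v : smooth_on U f -> smooth_on U g ->
  majorized U f A B v -> majorized U g A' B v ->
  majorized U (fun x => f x + g x) (A + A') B v.
Proof.
move=> sf sg Hf Hg a x Ux; rewrite /mpartial (partials_add oU _ sf sg Ux).
by apply: le_trans (ler_normD _ _) _; rewrite !mulrDl lerD ?Hf ?Hg.
Qed.

Lemma partials0 s : partials s (fun=> 0 : R) = (fun=> 0) :> ('rV[R]_n -> R).
Proof.
elim: s => [//|i s IH]; rewrite [LHS]/= IH.
by apply/funext => x; rewrite /partial derive_cst.
Qed.

Lemma majorized0 (A B : R) v : 0 <= A -> 0 <= B -> (forall k, 0 <= v k) ->
  majorized U (fun=> 0) A B v.
Proof.
by move=> A0 B0 v0 a x Ux; rewrite /mpartial partials0 normr0 !mulr_ge0 ?exprn_ge0.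
Qed.

Lemma majorized_sum (I : Type) (r : seq I) (F : I -> 'rV[R]_n -> R) (A B : R) v :
  0 <= A -> 0 <= B -> (forall k, 0 <= v k) ->
  (forall i, smooth_on U (F i)) -> (forall i, majorized U (F i) A B v) ->
  majorized U (fun x => \sum_(i <- r) F i x) ((size r)%:R * A) B v.
Proof.
move=> A0 B0 v0 sF HF; elim: r => [|i r IH].
  rewrite (_ : (fun x => _) = fun=> 0).
    by apply: majorized0; rewrite ?mul0r.
  by apply/funext => x; rewrite big_nil.
rewrite (_ : (fun x => _) = fun x => F i x + \sum_(j <- r) F j x); last first.
  by apply/funext => x; rewrite big_cons.
have -> : (size (i :: r))%:R * A = A + (size r)%:R * A.
  by rewrite /= -addn1 natrD mulrDl mul1r addrC.
exact: (majorized_add (sF i) (smooth_sum oU _ sF) (HF i) IH).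
Qed.

(** Membership in the class of weight [w], without record of the constants; it is
used for the functions that do not change during the iteration. *)
Definition majorizable f : Prop := smooth_on U f /\
  exists A B : R, [/\ 0 <= A, 0 <= B & majorized U f A B w].

Lemma majorizable_congr f g : (forall x, U x -> f x = g x) -> majorizable f -> majorizable g.
Proof.
move=> fg [sf [A [B [A0 B0 Hf]]]]; split; first exact: smooth_congr fg sf.
by exists A, B; split=> //; exact: majorized_congr fg Hf.
Qed.

Lemma majorizable_add f g : majorizable f -> majorizable g -> majorizable (fun x => f x + g x).
Proof.
move=> [sf [A [B [A0 B0 Hf]]]] [sg [A' [B' [A'0 B'0 Hg]]]].
split; first exact: smooth_add.
exists (A + A'), (B + B'); split; rewrite ?addr_ge0 //.
apply: majorized_add => //.
  by apply: majorizedW Hf => //; rewrite lerDl.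
by apply: majorizedW Hg => //; rewrite lerDr.
Qed.

Lemma majorizable_mul f g : majorizable f -> majorizable g -> majorizable (fun x => f x * g x).
Proof.
move=> [sf [A [B [A0 B0 Hf]]]] [sg [A' [B' [A'0 B'0 Hg]]]].
split; first exact: smooth_mul.
exists (2 ^+ n * (A * A') * C), (2 * B + B').
have B2 : 0 <= 2 * B by rewrite mulr_ge0.
split; rewrite ?mulr_ge0 ?addr_ge0 ?exprn_ge0 //.
apply: (@majorized_weight _ _ _ _ (fun k => C * w k)); rewrite ?mulr_ge0 ?addr_ge0 ?exprn_ge0 //.
apply: (@majorized_mul _ _ _ _ _ _ B _ _ w w) => //.
- by rewrite lerDl.
- by move=> i j; rewrite ww mulr_ge0 ?(ltW (w0 _)).
by apply: majorizedW Hg => //; rewrite lerDr.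
Qed.

Lemma majorizable_cst (c : R) : majorizable (fun=> c).
Proof.
split; first exact: smooth_cst.
exists (`|c| / w 0), 0; split=> //; first by rewrite divr_ge0 ?(ltW (w0 _)).
move=> a x Ux; rewrite /mpartial -/(mindex_seq a).
have := size_mindex_seq a; case/lastP: (mindex_seq a) => [<-|s i].
  rewrite expr0 mulr1 mulrAC divfK ?gt_eqF // ler_peMr // ler1n mfact_gt0.
  by [].
rewrite size_rcons => <-; rewrite -cats1 partials_cat /= (_ : partial i _ = fun=> 0).
  by rewrite partials0 normr0 !mulr_ge0 ?exprn_ge0 ?invr_ge0 ?(ltW (w0 _)).
by apply/funext => y; rewrite /partial derive_cst.
Qed.

Lemma majorizable_sum (I : Type) (r : seq I) (F : I -> 'rV[R]_n -> R) : (forall i, majorizable (F i)) ->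
  majorizable (fun x => \sum_(i <- r) F i x).
Proof.
move=> HF; elim: r => [|i r IH].
  by apply: majorizable_congr (majorizable_cst 0) => x _; rewrite big_nil.
by apply: majorizable_congr (majorizable_add (HF i) IH) => x _; rewrite big_cons.
Qed.

Lemma majorizable_prod (I : Type) (r : seq I) (F : I -> 'rV[R]_n -> R) : (forall i, majorizable (F i)) ->
  majorizable (fun x => \prod_(i <- r) F i x).
Proof.
move=> HF; elim: r => [|i r IH].
  by apply: majorizable_congr (majorizable_cst 1) => x _; rewrite big_nil.
by apply: majorizable_congr (majorizable_mul (HF i) IH) => x _; rewrite big_cons.
Qed.

Lemma majorizable_det m (F : 'rV[R]_n -> 'M[R]_m) : (forall i j, majorizable (fun x => F x i j)) ->
  majorizable (fun x => \det (F x)).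
Proof.
move=> HF; apply: majorizable_sum => s; apply: majorizable_mul; first exact: majorizable_cst.
by apply: majorizable_prod => i; exact: HF.
Qed.

Lemma majorizable_adj m (F : 'rV[R]_n -> 'M[R]_m) i j : (forall i j, majorizable (fun x => F x i j)) ->
  majorizable (fun x => (\adj (F x)) i j).
Proof.
move=> HF; have H : majorizable (fun x => (-1) ^+ (j + i) * \det (row' j (col' i (F x)))).
  apply: majorizable_mul; first exact: majorizable_cst.
  apply: majorizable_det => k l; apply: majorizable_congr (HF (lift j k) (lift i l)) => x _.
  by rewrite !mxE.
by apply: majorizable_congr H => x _; rewrite mxE.
Qed.

Lemma majorizable_uniform (I : finType) (F : I -> 'rV[R]_n -> R) : (forall i, majorizable (F i)) ->
  exists A B : R, [/\ 0 <= A, 0 <= B & forall i, majorized U (F i) A B w].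
Proof.
move=> HF.
have /choice[A /choice[B HAB]] : forall i, exists A B : R, [/\ 0 <= A, 0 <= B & majorized U (F i) A B w].
  by move=> i; case: (HF i).
exists (\sum_i A i), (\sum_i B i); split.
- by apply: sumr_ge0 => i _; have [] := HAB i.
- by apply: sumr_ge0 => i _; have [] := HAB i.
move=> i; have [A0 B0 H] := HAB i; apply: majorizedW H => //.
  rewrite (bigD1 i) //= lerDl; apply: sumr_ge0 => j _; by have [] := HAB j.
rewrite (bigD1 i) //= lerDl; apply: sumr_ge0 => j _; by have [] := HAB j.
Qed.

End Classes.

(** * Iterated derivatives along the mapping *)

Lemma smooth_comp (R : realType) n m (V : set 'rV[R]_n) (W : set 'rV[R]_m)
    (sigma : 'rV[R]_n -> 'rV[R]_m) h : open V -> open W ->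
  (forall x, V x -> W (sigma x)) -> (forall j, smooth_on V (fun x => sigma x ord0 j)) ->
  smooth_on W h -> smooth_on V (h \o sigma).
Proof.
move=> oV oW VW ss /smooth_Ck sh; apply/smooth_Ck => k.
apply: (Ck_comp oV oW VW) => // j.
by move: (ss j) => /smooth_Ck.
Qed.

Lemma bernoulli_le (R : realType) (y : R) k : 0 <= y -> 1 + k%:R * y <= (1 + y) ^+ k.
Proof.
move=> y0; elim: k => [|k IH]; first by rewrite mul0r addr0 expr0.
have p0 : 0 <= k%:R * y by rewrite mulr_ge0.
rewrite exprS; apply: (@le_trans _ _ ((1 + y) * (1 + k%:R * y))).
  rewrite -natr1; nra.
by rewrite ler_wpM2l // addr_ge0.
Qed.

(** With b = B(1 + s/(N+1)), the next rate is b(1 + y) with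
y = 1/(N+1+s) >= 1/(2(N+1)), and (1+y)^k >= 1 + k y by the Bernoulli
inequality. *)
Lemma rate_step (R : realType) (B : R) (N s k : nat) : 0 <= B -> (s <= N)%N ->
  k.+1%:R * (B * (1 + s%:R / N.+1%:R)) ^+ k.+1 <=
  4 * B * N.+1%:R * (B * (1 + s.+1%:R / N.+1%:R)) ^+ k.
Proof.
move=> B0 sN; set b := B * _; set b' := B * (1 + s.+1%:R / _).
have N0 : 0 < N.+1%:R :> R by rewrite ltr0n.
have q1 : s%:R / N.+1%:R <= 1 :> R by rewrite ler_pdivrMr // mul1r ler_nat leqW.
have q0 : 0 <= s%:R / N.+1%:R :> R by rewrite divr_ge0.
have b0 : 0 <= b by rewrite /b mulr_ge0 // addr_ge0.
have b2 : b <= 2 * B by rewrite /b mulrC ler_wpM2r // -[leRHS]/(1 + 1) lerD2l.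
pose y : R := (N.+1 + s)%:R^-1.
have y0 : 0 <= y by rewrite invr_ge0.
have bb : b' = b * (1 + y).
  have E (a d : R) : a != 0 -> a + d != 0 ->
      B * (1 + (d + 1) / a) = B * (1 + d / a) * (1 + (a + d)^-1).
    by move=> a0 ad0; field; rewrite a0 ad0.
  by rewrite /b' /b /y natrD -[s.+1]addn1 natrD E // -?natrD pnatr_eq0.
have y2 : 2 * N.+1%:R * y >= 1.
  rewrite /y ler_pdivlMr ?ltr0n // mul1r -natrM ler_nat; lia.
rewrite exprS bb [(b * (1 + y)) ^+ k]exprMn.
have H := bernoulli_le k y0.
have key : k.+1%:R <= 2 * N.+1%:R * (1 + y) ^+ k.
  apply: (@le_trans _ _ (2 * N.+1%:R * (1 + k%:R * y))).
    rewrite mulrDr mulr1 mulrCA -natr1 addrC lerD //.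
      have : 1 <= N.+1%:R :> R by rewrite ler1n.
      lra.
    by rewrite ler_peMr.
  by rewrite ler_wpM2l ?mulr_ge0.
rewrite (_ : 4 * B * N.+1%:R * (b ^+ k * (1 + y) ^+ k) =
  (2 * N.+1%:R * (1 + y) ^+ k) * ((2 * B) * b ^+ k)); last by ring.
by rewrite ler_pM ?mulr_ge0 ?exprn_ge0 // ler_wpM2r ?exprn_ge0.
Qed.

Lemma small_ratio (R : realType) (c X : R) : 0 < c -> 0 <= X ->
  exists r, [/\ 0 < r, r <= 2^-1 & 2 * r * X <= c / 2].
Proof.
move=> c0 X0; have den0 : 0 < 2 * c + 4 * X by lra.
exists (c / (2 * c + 4 * X)); split; first by rewrite divr_gt0.
  by rewrite ler_pdivrMr //; lra.
rewrite (_ : 2 * (c / (2 * c + 4 * X)) * X = c * (2 * X) / (2 * c + 4 * X)); last by ring.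
by rewrite ler_pdivrMr //; nra.
Qed.

Section Iteration.
Variables (R : realType) (n : nat) (M : nat -> R) (Q W : set 'rV[R]_n)
  (sigma : 'rV[R]_n -> 'rV[R]_n) (l : seq 'I_n)
  (alpha : 'I_n -> 'I_n -> 'rV[R]_n -> R) (v : 'rV[R]_n -> R)
  (A1 B1 A2 B2 c : R).
Hypotheses (hM : DC_weight M) (oQ : open Q) (oW : open W)
  (QW : forall x, Q x -> W (sigma x))
  (ssigma : forall j, smooth_on Q (fun x => sigma x ord0 j))
  (shrinkQ : forall i, i \in l -> forall t x, 0 <= t <= 1 -> Q x -> Q (shrink i t x))
  (salpha : forall i k, smooth_on Q (alpha i k))
  (A1_ge0 : 0 <= A1) (B1_ge0 : 0 <= B1)
  (Halpha : forall i k, majorized Q (alpha i k) A1 B1 (fun j => M (j + 1)%N))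
  (sv : smooth_on Q v)
  (A2_ge0 : 0 <= A2) (B2_ge0 : 0 <= B2)
  (Hv : majorized Q v A2 B2 (fun j => M (j + (size l).+1)%N))
  (c_gt0 : 0 < c) (v_ge : forall x, Q x -> c <= `|v x|)
  (rel : forall h, smooth_on W h -> forall i x, Q x ->
     \sum_k alpha i k x * partial k (h \o sigma) x =
     (\prod_(j <- l) x ord0 j) * (v x * partial i h (sigma x))).

Let p := (size l).+1.

(** One more derivative of [h], composed with [sigma]: a derivative of
[h \o sigma], products with [alpha], a sum, divisions by the coordinates
listed in [l] and a division by [v], in this order. *)
Lemma iteration_step h i (H b b' D r : R) q :
  smooth_on W h -> 0 <= H -> 0 <= D -> 0 <= b -> 0 <= r -> r <= 2^-1 ->
  2 * r * 2 ^+ n * A2 * M p <= c / 2 ->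
  2 * B1 <= b' -> B2 <= r * b' ->
  (forall k, k.+1%:R * b ^+ k.+1 <= D * b' ^+ k) ->
  majorized Q (h \o sigma) H b (fun j => M (j + q)%N) ->
  majorized Q (partial i h \o sigma)
    (2 * (n%:R * (2 ^+ n * (A1 * (H * D))) * M 1 * b' ^+ size l) / c) b'
    (fun j => M (j + (q + p))%N).
Proof.
move=> sh H0 D0 b0 r0 r2 small B1b B2b step Hh.
have b'0 : 0 <= b' by apply: le_trans B1b; rewrite mulr_ge0.
have M0 k : 0 <= M k := weight_ge0 hM k.
have shs := smooth_comp oQ oW QW ssigma sh.
have sph k : smooth_on Q (partial k (h \o sigma)) := @smooth_partials _ _ _ _ [:: k] shs.
have H1 k : majorized Q (partial k (h \o sigma)) (H * D) b' (fun j => M (j + q.+1)%N).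
  have := majorized_partial k oQ shs H0 b0 (fun j => M0 (j + q)%N) step Hh.
  by rewrite (_ : (fun j => M (j + q.+1)%N) = (fun j => M (j.+1 + q)%N)) //;
    apply/funext => j; rewrite addnS.
have HD0 : 0 <= H * D by rewrite mulr_ge0.
have H2 k : majorized Q (fun x => alpha i k x * partial k (h \o sigma) x)
    (2 ^+ n * (A1 * (H * D))) b' (fun j => M 1 * M (j + q.+1)%N).
  apply: (majorized_mul oQ (salpha i k) (sph k) A1_ge0 HD0 B1_ge0 B1b _ (Halpha i k) (H1 k)).
  by move=> a j; rewrite mulr_ge0 //= weight_shift_mul.
have K0 : 0 <= 2 ^+ n * (A1 * (H * D)) by rewrite mulr_ge0 ?exprn_ge0 ?mulr_ge0.
have ss k : smooth_on Q (fun x => alpha i k x * partial k (h \o sigma) x).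
  exact: (smooth_mul oQ (salpha i k) (sph k)).
have M10 j : 0 <= M 1 * M (j + q.+1)%N by rewrite mulr_ge0.
have H3 := majorized_sum oQ (index_enum 'I_n) K0 b'0 M10 ss H2.
have nE : size (index_enum 'I_n) = n by rewrite -[index_enum _]enumT size_enum_ord.
rewrite nE in H3.
have nK0 : 0 <= n%:R * (2 ^+ n * (A1 * (H * D))) by rewrite mulr_ge0.
have {}H3 := majorized_weight (fun j => lexx (M 1 * M (j + q.+1)%N)) nK0 b'0 H3.
have sS := smooth_sum oQ (index_enum 'I_n) ss.
have sk : smooth_on Q (fun x => v x * partial i h (sigma x)).
  apply: (smooth_mul oQ sv); apply: (smooth_comp oQ oW QW ssigma).
  exact: (@smooth_partials _ _ _ _ [:: i] sh).
have ck x : Q x -> {for x, continuous (fun x => v x * partial i h (sigma x))}.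
  by move=> /(sk [::])[].
have [_ H4] := majorized_division_seq oQ shrinkQ sS ck (rel sh i) H3.
have spi : smooth_on Q (partial i h \o sigma).
  by apply: (smooth_comp oQ oW QW ssigma); exact: (@smooth_partials _ _ _ _ [:: i] sh).
have {}H4 : majorized Q (fun x => v x * (partial i h \o sigma) x)
   (n%:R * (2 ^+ n * (A1 * (H * D))) * M 1 * b' ^+ size l) b' (fun j => M (j + (q + p))%N).
  have -> : (fun j => M (j + (q + p))%N) = (fun j => M (j + size l + q.+1)%N).
    by apply/funext => j; rewrite /p -[(j + _ + _)%N]addnA !addnS [(q + _)%N]addnC.
  exact: H4.
have nb0 : 0 <= n%:R * (2 ^+ n * (A1 * (H * D))) * M 1 * b' ^+ size l.
  by rewrite !mulr_ge0 ?exprn_ge0.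
apply: (majorized_quotient oQ sv spi A2_ge0 nb0 B2_ge0 b'0 c_gt0 r0 r2 B2b
  (fun j => M0 _) (fun j => M0 _) _ (M0 p) small v_ge Hv H4).
by move=> a j; apply: weight_shift_mul; rewrite // leq_addl.
Qed.

(** The number of steps is known in advance, which allows the increase of the
rate at each step to be of order 1/N. *)
Lemma iteration g (A0 B0 : R) : smooth_on W g -> 0 <= A0 -> 0 <= B0 ->
  majorized Q (g \o sigma) A0 B0 M ->
  exists2 K, 0 <= K & forall t x, Q x ->
   `|partials t g (sigma x)| <=
     A0 * (K * (size t).+1%:R) ^+ size t * M (size t * p)%N.
Proof.
move=> sg A00 B00 Hg; have M0 k : 0 <= M k := weight_ge0 hM k.
(* The ratio r is chosen for the division by v, and then B for the products
   and for the initial majorant. *)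
have [r [r_gt0 r2 small]] : exists r, [/\ 0 < r, r <= 2^-1 & 2 * r * 2 ^+ n * A2 * M p <= c / 2].
  have X0 : 0 <= 2 ^+ n * A2 * M p by rewrite !mulr_ge0 ?exprn_ge0.
  have [r [r_gt0 r2 small]] := small_ratio c_gt0 X0.
  by exists r; split=> //; rewrite !mulrA in small.
have B2r : 0 <= B2 / r by rewrite divr_ge0 // ltW.
have [B [B_ge0 B1B B2B B0B]] : exists B, [/\ 0 <= B, 2 * B1 <= B, B2 <= r * B & B0 <= B].
  have B12 : 0 <= 2 * B1 by rewrite mulr_ge0.
  exists (2 * B1 + B2 / r + B0); split; first by rewrite !addr_ge0.
  - by rewrite -addrA lerDl addr_ge0.
  - by rewrite mulrC -ler_pdivrMr // -addrA [_ + B0]addrC addrA lerDr addr_ge0.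
  - by rewrite lerDr addr_ge0.
have [K KE] : exists K, K = 2 * (n%:R * (2 ^+ n * (A1 * (4 * B))) * M 1 * (2 * B) ^+ size l) / c.
  by eexists.
have K0 : 0 <= K by rewrite KE divr_ge0 ?(ltW c_gt0) // !mulr_ge0 ?exprn_ge0 ?mulr_ge0.
exists K => // t; set N := size t.
(* All rates used in the N steps lie between B and 2 B. *)
pose rate (s : nat) := B * (1 + s%:R / N.+1%:R).
have le_rate s : B <= rate s by rewrite /rate ler_peMr // lerDl divr_ge0.
have rate_le2 s : (s <= N.+1)%N -> rate s <= 2 * B.
  move=> sN; have : s%:R / N.+1%:R <= 1 :> R by rewrite ler_pdivrMr ?ltr0n // mul1r ler_nat.
  by move=> H; rewrite /rate mulrC ler_wpM2r // -[leRHS]/(1 + 1) lerD2l.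
have main s : (size s <= N)%N -> majorized Q (partials s g \o sigma)
    (A0 * (K * N.+1%:R) ^+ size s) (rate (size s)) (fun j => M (j + size s * p)%N).
  elim: s => [_|i s IH sN].
    rewrite mulr1 (_ : (fun j => M _) = M); last by apply/funext => j; rewrite addn0.
    apply: (majorizedW (weight_gt0 hM) A00 B00 (lexx _) _ Hg).
    exact: le_trans (le_rate _).
  have Hs := IH (ltnW sN).
  have ssg := @smooth_partials _ _ _ _ s sg.
  have H0 : 0 <= A0 * (K * N.+1%:R) ^+ size s by rewrite !mulr_ge0 ?exprn_ge0 ?mulr_ge0.
  have D0 : 0 <= 4 * B * N.+1%:R by rewrite !mulr_ge0.
  have b0 : 0 <= rate (size s) by apply: le_trans (le_rate _).
  have b'0 : 0 <= rate (size s).+1 by apply: le_trans (le_rate _).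
  have B1b : 2 * B1 <= rate (size s).+1 by apply: le_trans (le_rate _).
  have B2b : B2 <= r * rate (size s).+1.
    by apply: le_trans B2B _; rewrite ler_wpM2l // ltW.
  have := iteration_step i ssg H0 D0 b0 (ltW r_gt0) r2 small B1b B2b
    (fun k => rate_step k B_ge0 (ltnW sN)) Hs.
  rewrite [size (i :: s)]/= mulSn addnC.
  apply: (majorizedW (fun j => weight_gt0 hM _)) => //.
    by rewrite divr_ge0 ?(ltW c_gt0) // !mulr_ge0 ?exprn_ge0 ?mulr_ge0.
  rewrite exprS.
  rewrite (_ : A0 * (K * N.+1%:R * (K * N.+1%:R) ^+ size s) = K *
     (A0 * (K * N.+1%:R) ^+ size s * N.+1%:R)); last by ring.
  set E := A0 * _ ^+ _ in H0 *; rewrite {1}KE.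
  rewrite (_ : 2 * (n%:R * (2 ^+ n * (A1 * (E * (4 * B * N.+1%:R)))) * M 1 * rate (size s).+1 ^+ size l) / c =
    (2 * (n%:R * (2 ^+ n * (A1 * (4 * B))) * M 1) / c * (E * N.+1%:R)) * rate (size s).+1 ^+ size l);
    last by ring.
  rewrite (_ : 2 * (n%:R * (2 ^+ n * (A1 * (4 * B))) * M 1 * (2 * B) ^+ size l) / c * (E * N.+1%:R) =
    (2 * (n%:R * (2 ^+ n * (A1 * (4 * B))) * M 1) / c * (E * N.+1%:R)) * (2 * B) ^+ size l);
    last by ring.
  rewrite ler_wpM2l //.
    by rewrite mulr_ge0 ?divr_ge0 ?(ltW c_gt0) // ?mulr_ge0 ?exprn_ge0 // ?mulr_ge0.
  by apply: lerXn2r; [rewrite nnegrE|rewrite nnegrE mulr_ge0|exact/rate_le2/ltnW].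
by move=> x Qx; exact: (majorized_norm (main t (leqnn _)) Qx).
Qed.

End Iteration.

(** * Factorials and multi-indices *)

Lemma bin_le_exp2 n m : ('C(n, m) <= 2 ^ n)%N.
Proof.
elim: n m => [|n IH] [|m]; rewrite ?bin0 ?expn_gt0 //.
by rewrite binS expnS mul2n -addnn leq_add.
Qed.

(** (N+1)^N is at most (N+1)(N+2)...(2N), which is N! times a central binomial
coefficient. *)
Lemma succ_expn_le_fact N : (N.+1 ^ N <= 4 ^ N * N`!)%N.
Proof.
have H j : (j <= N)%N -> (N.+1 ^ j <= (N + N) ^_ j)%N.
  elim: j => [//|j IH] jN; rewrite expnSr ffactnSr leq_mul ?IH ?(ltnW jN) //.
  by rewrite -addnBA ?(ltnW jN) // -addn1 leq_add2l subn_gt0.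
apply: leq_trans (H N (leqnn _)) _; rewrite -bin_ffact leq_mul2r; apply/orP; right.
by apply: leq_trans (bin_le_exp2 _ _) _; rewrite addnn -mul2n expnM.
Qed.

(** A multinomial coefficient is a product of binomial coefficients, each of
which is bounded by a power of 2. *)
Lemma fact_sum_le (I : Type) (r : seq I) (F : I -> nat) :
  ((\sum_(i <- r) F i)`! <= 2 ^ (size r * \sum_(i <- r) F i) * \prod_(i <- r) (F i)`!)%N.
Proof.
elim: r => [|i r IH]; first by rewrite !big_nil.
rewrite !big_cons; set S := (\sum_(j <- r) F j)%N; rewrite -/S in IH.
rewrite -(bin_fact (leq_addr S (F i))) addKn /= mulSn expnD -mulnA.
apply: leq_mul; first exact: bin_le_exp2.
rewrite [leqRHS]mulnCA leq_mul2l; apply/orP; right; apply: leq_trans IH _.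
by rewrite leq_mul2r leq_exp2l // leq_mul2l leq_addl !orbT.
Qed.

Lemma mdeg_fact_le n (b : mindex n) : ((mdeg b)`! <= 2 ^ (n * mdeg b) * mfact b)%N.
Proof.
have := fact_sum_le (index_enum 'I_n) b.
suff -> : size (index_enum 'I_n) = n by [].
by rewrite -[index_enum _]enumT size_enum_ord.
Qed.

Lemma succ_expn_le_mfact n (b : mindex n) :
  ((mdeg b).+1 ^ mdeg b <= (4 * 2 ^ n) ^ mdeg b * mfact b)%N.
Proof.
apply: leq_trans (succ_expn_le_fact _) _.
by rewrite expnMn -mulnA leq_mul2l -expnM mdeg_fact_le orbT.
Qed.

Lemma weight_shift_le (R : realType) (M : nat -> R) p q : DC_weight M -> (p <= q)%N ->
  exists2 c : R, 0 < c & forall N, M (p * N)%N <= c ^+ N * M (q * N)%N.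
Proof.
move=> hM pq; have r0 : 0 < M 1 / M 0 by rewrite divr_gt0 ?(weight_gt0 hM).
exists ((M 1 / M 0) ^- (q - p)); first by rewrite invr_gt0 exprn_gt0.
move=> N; have := weight_enlarge hM ((q - p) * N) (p * N).
rewrite -mulnDl subnK // exprVn -exprM => H.
by rewrite ler_pdivlMl ?exprn_gt0.
Qed.

(** * From local to compact estimates *)

Section LocalBound.
Variables (R : realType) (n : nat) (M : nat -> R)
    (V W : set 'rV[R]_n) (sigma : 'rV[R]_n -> 'rV[R]_n)
    (gamma : mindex n) (u : 'rV[R]_n -> R) (g : 'rV[R]_n -> R).
Hypotheses (hM : DC_weight M)
    (oV : open V) (oW : open W)
    (sigmaVW : sigma @` V `<=` W)
    (sigmaM : DC_class_map M V sigma)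
    (u_cont : forall x, V x -> {for x, continuous u})
    (u_neq0 : forall x, V x -> u x != 0)
    (detE : forall x, V x -> \det ('J sigma x) = monomial gamma x * u x)
    (g_smooth : smooth_on W g)
    (gsigmaM : DC_class M V (g \o sigma)).

Local Notation coord j := (fun x : 'rV[R]_n => sigma x ord0 j).

Lemma monomial_mindex_seq (b : mindex n) (x : 'rV[R]_n) :
  \prod_(i <- mindex_seq b) x ord0 i = monomial b x.
Proof.
rewrite /mindex_seq big_flatten big_map big_enum /=; apply: eq_bigr => i _.
by rewrite big_nseq iter_mulr_1.
Qed.

Lemma monomial_continuous (b : mindex n) : continuous (monomial b : 'rV[R]_n -> R).
Proof.
rewrite (_ : monomial b = fun x : 'rV[R]_n => \prod_(i <- mindex_seq b) x ord0 i).
  exact: coord_prod_continuous.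
by apply/funext => y; rewrite monomial_mindex_seq.
Qed.

Definition partial_mx (x : 'rV[R]_n) : 'M[R]_n := \matrix_(i, j) partial i (coord j) x.

Lemma sigma_smooth j : smooth_on V (coord j).
Proof. by case: (sigmaM j). Qed.

Lemma sigma_differentiable x : V x -> differentiable sigma x.
Proof.
by move=> Vx; apply: differentiable_rV => j; exact: smooth_differentiable (sigma_smooth j) Vx.
Qed.

Lemma jacobian_partial_mx x : V x -> 'J sigma x = partial_mx x.
Proof.
move=> Vx; apply/matrixP => i j; rewrite !mxE.
exact: derive_coord (sigma_differentiable Vx).
Qed.

(** The chain rule solved for the derivatives of [h] by multiplication with the
adjugate matrix. *)
Lemma adjugate_chain_rule h i x : smooth_on W h -> V x ->
  \sum_k (\adj (partial_mx x)) i k * partial k (h \o sigma) x =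
  \det (partial_mx x) * partial i h (sigma x).
Proof.
move=> sh Vx; have Wx : W (sigma x) by apply: sigmaVW; exists x.
have dh := smooth_differentiable oW sh Wx.
have ds := sigma_differentiable Vx.
pose G : 'cV[R]_n := \col_k partial k h (sigma x).
have E : partial_mx x *m G = \col_k partial k (h \o sigma) x.
  apply/colP => k; rewrite !mxE (chain_rule k dh ds); apply: eq_bigr => j _.
  by rewrite !mxE mulrC.
have := congr1 (fun A : 'cV[R]_n => A i ord0) (mulmxA (\adj (partial_mx x)) (partial_mx x) G).
rewrite mul_adj_mx mul_scalar_mx E !mxE => <-.
by apply: eq_bigr => k _; rewrite !mxE.
Qed.

(** The iteration on a cube around [a]; the monomial is split according to the
coordinates of [a] that vanish. *)
Lemma local_bound (a : 'rV[R]_n) : V a ->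
  exists r A B : R, [/\ 0 < r, 0 < A, 0 < B & forall x, ball a r x ->
    forall b : mindex n, `|mpartial b g (sigma x)| <=
      A * B ^+ mdeg b * (mfact b)%:R * M ((mdeg gamma + 1) * mdeg b)%N].
Proof.
move=> Va.
(* gamma0 keeps the exponents of the coordinates vanishing at a; x^gamma1 does
   not vanish near a and goes into the unit v. *)
pose gamma0 : mindex n := [ffun i => if a ord0 i == 0 then gamma i else 0%N].
pose gamma1 : mindex n := [ffun i => if a ord0 i == 0 then 0%N else gamma i].
have gammaE x : monomial gamma x = monomial gamma0 x * monomial gamma1 x.
  rewrite /monomial -big_split; apply: eq_bigr => i _ /=; rewrite !ffunE.
  by case: ifP => _; rewrite expr0 ?mulr1 ?mul1r.
pose v (x : 'rV[R]_n) : R := monomial gamma1 x * u x.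
have v_cont x : V x -> {for x, continuous v}.
  by move=> Vx; apply: continuousM; [exact: monomial_continuous|exact: u_cont].
have va0 : 0 < `|v a|.
  rewrite normr_gt0 mulf_neq0 ?u_neq0 //; apply/prodf_neq0 => i _; rewrite ffunE.
  case: (a ord0 i =P 0) => [_|/eqP ai]; [exact: oner_neq0|exact: expf_neq0].
pose c := `|v a| / 2.
have c0 : 0 < c by rewrite divr_gt0.
have /nbhs_ballP[d /= d0 dB] : \forall x \near a, V x /\ c <= `|v x|.
  have cva := v_cont a Va.
  have n1 := (@cvgrPdist_le R R^o _ _ (nbhs_filter a) _ _).1 cva _ c0.
  apply: filterS2 (open_near oV Va) n1 => x Vx vx; split=> //.
  have := ler_normD (v a - v x) (v x); rewrite subrK => H.
  by move: vx H; rewrite /c; move: `|v a| `|v x| `|v a - v x| => X Y Z; lra.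
pose r := d / 2.
have r0 : 0 < r by rewrite divr_gt0.
have rd : r < d by rewrite /r; lra.
pose Q := ball a r : set 'rV[R]_n.
have oQ : open Q by exact: ball_open.
(* The hypotheses give estimates on compact sets: K is a closed cube between
   the open cube Q and the ball of radius d. *)
pose K := [set x : 'rV[R]_n | forall i, `[a ord0 i - r, a ord0 i + r]%classic (x ord0 i)].
have cK : compact K.
  apply: (@rV_compact R n (fun i => `[a ord0 i - r, a ord0 i + r]%classic)) => i.
  exact: segment_compact.
have KB x : K x -> ball a d x.
  move=> Kx; rewrite -ball_normE /= [ltLHS]/Num.norm/= mx_normrE.
  apply/bigmax_ltP; split=> // -[i j] _ /=; rewrite ord1 !mxE.
  have := Kx j; rewrite /= in_itv/= => /andP[x1 x2].
  by apply: le_lt_trans rd; rewrite ler_norml; apply/andP; split; lra.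
have KV : K `<=` V by move=> x /KB /dB[].
have Qcoord x i : Q x -> `|a ord0 i - x ord0 i| < r.
  rewrite /Q -ball_normE /= => H; apply: le_lt_trans H.
  by have := coord_le_norm (a - x) i; rewrite !mxE.
have QK x : Q x -> K x.
  move=> Qx i /=; rewrite in_itv/=; have := Qcoord x i Qx.
  by rewrite ltr_norml => /andP[x1 x2]; apply/andP; split; lra.
have QV x : Q x -> V x by move=> /QK; exact: KV.
have restr f : smooth_on V f -> smooth_on Q f by move=> sf s x /QV; exact: sf.
have sQ j : smooth_on Q (coord j) by apply/restr/sigma_smooth.
pose w1 j := M (j + 1)%N.
have w1_gt0 j : 0 < w1 j by exact: (weight_gt0 hM).
have w1_mul i j : w1 i * w1 j <= M 1 * w1 (i + j)%N by exact: (weight_shift_mul hM).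
have M1_ge0 : 0 <= M 1 := weight_ge0 hM 1.
have maj_partial_mx i j : majorizable Q w1 (fun x => partial_mx x i j).
  have [_ /(_ K cK KV)[A [B [A0 B0 HAB]]]] := sigmaM j.
  have Hm : majorized Q (coord j) A B M by move=> b x /QK; exact: HAB.
  (* For a single derivative, doubling the rate is enough: k + 1 <= 2^k. *)
  have step k : k.+1%:R * B ^+ k.+1 <= B * (2 * B) ^+ k.
    rewrite exprS exprMn mulrCA ler_wpM2l ?(ltW B0) // ler_wpM2r ?exprn_ge0 ?(ltW B0) //.
    by rewrite -natrX ler_nat ltn_expl.
  have := majorized_partial i oQ (sQ j) (ltW A0) (ltW B0) (weight_ge0 hM) step Hm.
  rewrite (_ : (fun k => M k.+1) = w1); last by apply/funext => k; rewrite /w1 addn1.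
  move=> H; apply: (majorizable_congr (f := partial i (coord j)) oQ); first by move=> x _; rewrite mxE.
  split; first exact: (@smooth_partials _ _ _ _ [:: i] (sQ j)).
  by exists (A * B), (2 * B); split; rewrite ?mulr_ge0 ?ltW.
have [sdet [Ad [Bd [Ad0 Bd0 Hdet]]]] := majorizable_det oQ w1_gt0 M1_ge0 w1_mul maj_partial_mx.
have [A1 [B1 [A10 B10 Hadj]]] := majorizable_uniform w1_gt0
  (fun ik : 'I_n * 'I_n => majorizable_adj oQ w1_gt0 M1_ge0 w1_mul ik.1 ik.2 maj_partial_mx).
have sadj i k : smooth_on Q (fun x => (\adj (partial_mx x)) i k).
  by have [] := majorizable_adj oQ w1_gt0 M1_ge0 w1_mul i k maj_partial_mx.
have detQ x : Q x -> \det (partial_mx x) = (\prod_(i <- mindex_seq gamma0) x ord0 i) * v x.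
  by move=> /QV Vx; rewrite -jacobian_partial_mx // detE // gammaE monomial_mindex_seq mulrA.
have shrinkQ i : i \in mindex_seq gamma0 -> forall t x, 0 <= t <= 1 -> Q x -> Q (shrink i t x).
  move=> il t x /andP[t0 t1] Qx.
  have ai : a ord0 i = 0.
    apply/eqP; move: il; rewrite -has_pred1 has_count count_mindex_seq ffunE.
    by case: eqP.
  rewrite /Q -ball_normE /= [ltLHS]/Num.norm/= mx_normrE.
  apply/bigmax_ltP; split=> // -[k j] _ /=; rewrite ord1.
  have -> : (a - shrink i t x) ord0 j = a ord0 j - shrink i t x ord0 j by rewrite !mxE.
  rewrite shrinkE.
  have := Qcoord x j Qx; case: eqP => [->|_]; rewrite ?mul1r // ai !sub0r !normrN.
  by apply: le_lt_trans; rewrite normrM ger0_norm // ler_piMl.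
have v_contQ x : Q x -> {for x, continuous v} by move=> /QV; exact: v_cont.
have [sv Hv] := majorized_division_seq oQ shrinkQ sdet v_contQ detQ Hdet.
set l := mindex_seq gamma0 in sv Hv shrinkQ detQ.
have {}Hv : majorized Q v (Ad * Bd ^+ size l) Bd (fun j => M (j + (size l).+1)%N).
  rewrite (_ : (fun j => _) = (fun j => w1 (j + size l)%N)) //.
  by apply/funext => j; rewrite /w1 addn1 addnS.
have Av0 : 0 <= Ad * Bd ^+ size l by rewrite mulr_ge0 ?exprn_ge0.
have vc x : Q x -> c <= `|v x| by move=> /QK /KB /dB[].
have rel h : smooth_on W h -> forall i x, Q x ->
     \sum_k (\adj (partial_mx x)) i k * partial k (h \o sigma) x =
     (\prod_(j <- l) x ord0 j) * (v x * partial i h (sigma x)).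
  by move=> sh i x Qx; rewrite adjugate_chain_rule ?detQ ?mulrA //; exact: QV.
have [_ /(_ K cK KV)[A0 [B0 [A0_gt0 B0_gt0 Hg]]]] := gsigmaM.
have Hgm : majorized Q (g \o sigma) A0 B0 M by move=> b x /QK; exact: Hg.
have QW x : Q x -> W (sigma x) by move=> /QV Vx; apply: sigmaVW; exists x.
have [L L0 main] := iteration hM oQ oW QW sQ shrinkQ sadj A10 B10
  (fun i k => Hadj (i, k)) sv Av0 Bd0 Hv c0 vc rel g_smooth (ltW A0_gt0) (ltW B0_gt0) Hgm.
have pq : ((size l).+1 <= mdeg gamma + 1)%N.
  rewrite addn1 ltnS size_mindex_seq; apply: leq_sum => i _; rewrite ffunE.
  by case: ifP.
have [e e0 He] := weight_shift_le hM pq.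
exists r, A0, (L * (4 * 2 ^+ n) * e + 1); split=> //.
  by rewrite ltr_wpDl // !mulr_ge0 ?exprn_ge0 // ltW.
move=> x Qx b; have := main (mindex_seq b) x Qx; rewrite size_mindex_seq => H.
apply: le_trans H _; rewrite -!mulrA ler_wpM2l ?(ltW A0_gt0) //.
rewrite (_ : L * (4 * (2 ^+ n * e)) = L * (4 * 2 ^+ n) * e); last by rewrite !mulrA.
set N := mdeg b.
have MN : 0 <= M ((mdeg gamma + 1) * N)%N := weight_ge0 hM _.
have P0 : 0 <= L * (4 * 2 ^+ n) * e by rewrite !mulr_ge0 ?exprn_ge0 // ltW.
apply: (@le_trans _ _ ((L * (4 * 2 ^+ n) * e) ^+ N * ((mfact b)%:R * M ((mdeg gamma + 1) * N)%N))); last first.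
  apply: ler_wpM2r; first by rewrite mulr_ge0.
  have P1 : 0 <= L * (4 * 2 ^+ n) * e + 1 by rewrite addr_ge0.
  by apply: lerXn2r; [exact: P0|exact: P1|rewrite lerDl].
have F : (N.+1%:R : R) ^+ N <= (4 * 2 ^+ n) ^+ N * (mfact b)%:R.
  by have := succ_expn_le_mfact b; rewrite -(ler_nat R) natrM !natrX natrM natrX.
have E : M (N * (size l).+1)%N <= e ^+ N * M ((mdeg gamma + 1) * N)%N.
  by rewrite mulnC; exact: He.
rewrite !exprMn.
have LN : 0 <= L ^+ N by rewrite exprn_ge0.
apply: (@le_trans _ _ (L ^+ N * ((4 * 2 ^+ n) ^+ N * (mfact b)%:R) *
   (e ^+ N * M ((mdeg gamma + 1) * N)%N))).
  rewrite ler_pM ?mulr_ge0 ?exprn_ge0 ?(weight_ge0 hM) // ler_wpM2l //.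
rewrite exprMn le_eqVlt; apply/orP; left; apply/eqP; ring.
Qed.

(** The local constants are replaced by a single constant tending to
infinity, for which the estimate is monotone. *)
Lemma compact_bound (K : set 'rV[R]_n) : compact K -> K `<=` V ->
  DC_bounds (shift_weight (mdeg gamma + 1)%N M) g (sigma @` K).
Proof.
move=> cK KV.
pose P (C : R) (x : 'rV[R]_n) := forall b : mindex n, `|mpartial b g (sigma x)| <=
  C * C ^+ mdeg b * (mfact b)%:R * M ((mdeg gamma + 1) * mdeg b)%N.
have near_P x : K x -> \forall x' \near x & C \near +oo, P C x'.
  move=> /KV Vx; have [r [A [B [r0 A0 B0 H]]]] := local_bound Vx.
  exists (ball x r, [set C | A <= C /\ B <= C]) => /=.
    split; first exact: nbhsx_ballx.
    by apply: filterI; exact: nbhs_pinfty_ge (num_real _).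
  move=> [x' C] /= [xx' [AC BC]] b; apply: le_trans (H _ xx' b) _.
  have A0' := ltW A0; have B0' := ltW B0; have C0 := le_trans A0' AC.
  rewrite ler_wpM2r ?(weight_ge0 hM) // ler_wpM2r //.
  apply: ler_pM; [exact: A0'|exact: exprn_ge0|exact: AC|].
  by apply: lerXn2r; rewrite ?nnegrE.
have := (compact_near_coveringP K).1 cK _ _ P _ near_P => /(_ _)/wrap[] nP.
have [C [C0 HC]] : exists C : R, 0 < C /\ K `<=` P C.
  have FP : ProperFilter (pinfty_nbhs R) by exact: proper_pinfty_nbhs.
  have [|C [ContinuousPartials C2]] := @filter_ex _ _ FP ([set C | 0 < C] `&` [set C | K `<=` P C]).
    by apply: filterI nP; exact: nbhs_pinfty_gt (num_real _).
  by exists C.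
exists C, C; split=> // b _ [x Kx <-].
exact: HC.
Qed.

End LocalBound.

Lemma DC_bounds_shift_le (R : realType) n (M : nat -> R) p q (f : 'rV[R]_n -> R) K :
  DC_weight M -> (p <= q)%N ->
  DC_bounds (shift_weight p M) f K -> DC_bounds (shift_weight q M) f K.
Proof.
move=> hM pq [A [B [A0 B0 H]]]; have [c c0 Hc] := weight_shift_le hM pq.
exists A, (B * c); split; rewrite ?mulr_gt0 // => b x Kx.
apply: le_trans (H b x Kx) _; rewrite /shift_weight exprMn.
rewrite (_ : A * (B ^+ mdeg b * c ^+ mdeg b) * (mfact b)%:R * M (q * mdeg b)%N =
  A * B ^+ mdeg b * (mfact b)%:R * (c ^+ mdeg b * M (q * mdeg b)%N)); last by ring.
by rewrite ler_wpM2l ?Hc // !mulr_ge0 ?exprn_ge0 // ltW.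
Qed.

Theorem theorem1p4 (R : realType) (n : nat) (M : nat -> R)
    (V W : set 'rV[R]_n) (sigma : 'rV[R]_n -> 'rV[R]_n)
    (gamma : mindex n) (u : 'rV[R]_n -> R) (g : 'rV[R]_n -> R)
    (hM : DC_weight M)
    (oV : open V) (oW : open W)
    (sigmaVW : sigma @` V `<=` W)
    (sigmaM : DC_class_map M V sigma)
    (u_cont : forall x, V x -> {for x, continuous u})
    (u_neq0 : forall x, V x -> u x != 0)
    (detE : forall x, V x -> \det ('J sigma x) = monomial gamma x * u x)
    (g_smooth : smooth_on W g)
    (gsigmaM : DC_class M V (g \o sigma)) :
  (forall K : set 'rV[R]_n, compact K -> K `<=` V ->
     DC_bounds (shift_weight (2 * mdeg gamma + 1)%N M) g (sigma @` K)) /\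
  (DC_diff_closed n M \/ DC_quasianalytic M ->
   forall K : set 'rV[R]_n, compact K -> K `<=` V ->
     DC_bounds (shift_weight (mdeg gamma + 1)%N M) g (sigma @` K)).
Proof.
have main := compact_bound hM oV oW sigmaVW sigmaM u_cont u_neq0 detE g_smooth gsigmaM.
split=> [K cK KV|_]; last exact: main.
apply: (DC_bounds_shift_le hM _ (main K cK KV)).
by rewrite leq_add2r mul2n -addnn leq_addr.
Qed.
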